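(* Let $f:\mathbb R^+\times L^2(\Omega)\to L^2(\Omega)$ be a continuous mapping such that $f(\cdot,0)=0$ and, for every $r\ge0$, $\|f(t,v_1)-f(t,v_2)\|\le p(t)\kappa(r)\|v_1-v_2\|$ for all $t\in\mathbb R^+$ and $v_1,v_2\in L^2(\Omega)$ with $\|v_1\|,\|v_2\|\le r$, where $p\in L^\infty(\mathbb R^+)$ is a nonnegative function and $\kappa:[0,\infty)\to\mathbb R$ is a continuous function satisfying $$\|p\|_\infty\cdot\limsup_{r\to0}\kappa(r)<\lambda_1.$$ Then the zero solution of the delayed Rayleigh-Stokes equation $\partial_tu-(1+\gamma\partial_t^\alpha)\Delta u=f(t,u_\rho)$ in $\Omega$, $t>0$ (with $u=0$ on $\partial\Omega$ and initial condition $u=\xi$ on $[-\tau,0]$) is asymptotically stable.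
   Context: Setting: $\Omega\subset\mathbb R^d$ is a bounded domain with smooth boundary, $\gamma>0$, $\alpha\in(0,1)$, $\tau\ge 0$, and $\rho:\mathbb R^+=[0,\infty)\to\mathbb R$ is continuous with $-\tau\le t-\rho(t)\le t$ for all $t\ge0$ and $\lim_{t\to\infty}(t-\rho(t))=\infty$; $u_\rho(x,t)=u(x,t-\rho(t))$. $\|\cdot\|$ is the norm of $L^2(\Omega)$; $\|\xi\|_\infty$ is the sup norm in $C([-\tau,0];L^2(\Omega))$; $\|p\|_\infty$ is the essential supremum. $\partial_t^\alpha v(t)=\frac{d}{dt}\int_0^tg_{1-\alpha}(t-s)v(s)ds$ is the Riemann-Liouville derivative, $g_\beta(t)=t^{\beta-1}/\Gamma(\beta)$. For $\mu>0$, $\omega(\cdot,\mu)$ is the unique solution of $\omega'(t)+\mu(1+\gamma\partial_t^\alpha)\omega(t)=0$ for $t>0$, $\omega(0)=1$; equivalently, the unique continuous solution of $\omega(t)+\mu\int_0^t(1+\gamma g_{1-\alpha}(t-s))\omega(s)ds=1$, $t\ge0$. $\{\varphi_n\}_{n\ge1}$ is an orthonormal basis of $L^2(\Omega)$ consisting of eigenfunctions of $-\Delta$ with homogeneous Dirichlet boundary condition, $-\Delta\varphi_n=\lambda_n\varphi_n$, with $0<\lambda_1\le\lambda_2\le\cdots\to\infty$. The resolvent operator $S(t):L^2(\Omega)\to L^2(\Omega)$ is $S(t)v=\sum_{n=1}^\infty\omega(t,\lambda_n)\langle v,\varphi_n\rangle\varphi_n$, $t\ge0$. Mild solution on $[-\tau,\infty)$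 with initial datum $\xi\in C([-\tau,0];L^2(\Omega))$: a continuous $u:[-\tau,\infty)\to L^2(\Omega)$ with $u(\cdot,s)=\xi(\cdot,s)$ for $s\in[-\tau,0]$ and $u(\cdot,t)=S(t)\xi(\cdot,0)+\int_0^tS(t-s)f(s,u_\rho(\cdot,s))ds$ for all $t\ge0$. Asymptotic stability of the zero solution means: there is $\delta_0>0$ such that for every $\xi$ with $\|\xi\|_\infty\le\delta_0$ a mild solution on $[-\tau,\infty)$ exists and every such mild solution satisfies $\lim_{t\to\infty}\|u(\cdot,t)\|=0$; and for every $\varepsilon>0$ there is $\delta\in(0,\delta_0]$ such that $\|\xi\|_\infty\le\delta$ implies $\|u(\cdot,t)\|\le\varepsilon$ for all $t\ge0$, for every mild solution $u$ on $[-\tau,\infty)$ with initial datum $\xi$. *)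

(* Defs.v *)
From HB Require Import structures.
From mathcomp Require Import all_boot all_order all_algebra.
From mathcomp Require Import all_classical all_reals all_analysis.
From mathcomp Require Import measurable_realfun ess_sup_inf.
Set Implicit Arguments. Unset Strict Implicit. Unset Printing Implicit Defensive.
Import Order.TTheory GRing.Theory Num.Theory.
Import numFieldNormedType.Exports.
Local Open Scope classical_set_scope.
Local Open Scope ring_scope.

(* R^d carries the product (i.e. Borel) sigma-algebra; its topology is the one
   of the sup norm on 'rV[R]_d *)
Section measurable_rV.
Context (R : realType) (d : nat).

Let coord : 'I_d -> 'rV[R]_d -> measurableTypeR R := fun i x => x ord0 i.

Let rV_set0 : g_sigma_preimage coord set0.
Proof. exact: sigma_algebra0. Qed.

Let rV_setC A : g_sigma_preimage coord A -> g_sigma_preimage coord (~` A).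
Proof. exact: sigma_algebraC. Qed.

Let rV_bigcup (F : _^nat) : (forall i, g_sigma_preimage coord (F i)) ->
  g_sigma_preimage coord (\bigcup_i (F i)).
Proof. exact: sigma_algebra_bigcup. Qed.

HB.instance Definition _ := @isMeasurable.Build default_measure_display
  'rV[R]_d (g_sigma_preimage coord) rV_set0 rV_setC rV_bigcup.

Lemma measurable_coord_rV (i : 'I_d) :
  measurable_fun [set: 'rV[R]_d] (fun x : 'rV[R]_d => x ord0 i).
Proof.
move=> _ Y mY; rewrite setTI; apply: sub_sigma_algebra => /=.
rewrite -bigcup_seq/=; exists i => /=; first by rewrite mem_index_enum.
by exists Y => //; rewrite setTI.
Qed.

Lemma measurable_fun_rV d1 (T : measurableType d1) (f : T -> 'rV[R]_d) :
  (forall i, measurable_fun setT (fun t => f t ord0 i)) ->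
  measurable_fun setT f.
Proof.
move=> mf _ A mA; rewrite setTI.
have : preimage_set_system setT f (g_sigma_preimage coord) (f @^-1` A).
  by exists A => //; rewrite setTI.
rewrite -g_sigma_preimage_comp.
apply: smallest_sub; first exact: sigma_algebra_measurable.
rewrite -bigcup_seq => /= B [i _] [C mC <-].
exact: mf.
Qed.

End measurable_rV.

Lemma open_measurable_rV (R : realType) d (A : set 'rV[R]_d) :
  open A -> measurable A.
Proof.
move=> oA.
pose box (q : 'rV[rat]_d * nat) : set 'rV[R]_d :=
  \bigcap_(i in [set: 'I_d]) [set x | ball (ratr (q.1 ord0 i) : R) q.2.+1%:R^-1 (x ord0 i)].
pose F q := if `[< box q `<=` A >] then box q else set0.
have -> : A = \bigcup_q F q.
  apply/seteqP; split=> [x Ax|x [q _]]; last first.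
    by rewrite /F; case: asboolP => // + bx; exact.
  have /nbhs_ballP[e /= e0 xeA] : nbhs x A by exact: open_nbhs_nbhs.
  have [k ke] : exists k, k.+1%:R^-1 < e / 2.
    have e20 : 0 < e / 2 by rewrite divr_gt0.
    have [k _ /(_ k (leqnn k)) ke] := near_infty_natSinv_lt (PosNum e20).
    by exists k.
  have qP i : exists q : rat, ball (ratr q : R) k.+1%:R^-1 (x ord0 i).
    have k0 : x ord0 i - k.+1%:R^-1 < x ord0 i + k.+1%:R^-1 :> R.
      by rewrite ltrBlDr -addrA ltrDl addr_gt0.
    have [q] := rat_in_itvoo k0.
    rewrite in_itv/= => /andP[q1 q2]; exists q.
    by rewrite /ball/= ltr_distlC; apply/andP; split; [rewrite ltrBlDr|rewrite -ltrBlDr].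
  exists (\row_i projT1 (cid (qP i)), k) => //.
  rewrite /F asboolT.
    by move=> i _ /=; rewrite mxE; case: cid.
  move=> y /= yb; apply: xeA; split => // i j; rewrite ord1.
  have := yb j I; rewrite /= mxE; case: cid => q /= qx qy.
  rewrite [e]splitr; apply: (@ball_triangle _ _ (ratr q : R)).
    by apply: ball_sym; apply: le_ball qx; exact: ltW.
  by apply: le_ball qy; exact: ltW.
apply: countable_bigcupT_measurable => // q.
rewrite /F; case: asboolP => // _.
apply: fin_bigcap_measurable => // i _.
have := @measurable_coord_rV R d i measurableT (ball (ratr (q.1 ord0 i) : R) q.2.+1%:R^-1).
by rewrite setTI; apply; exact: measurable_ball.
Qed.

Section lebesgue_rV.
Context (R : realType).

Definition cons_rV d (x : measurableTypeR R * 'rV[R]_d) : 'rV[R]_(1 + d) :=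
  row_mx (const_mx x.1) x.2.

Definition uncons_rV d (v : 'rV[R]_(1 + d)) : measurableTypeR R * 'rV[R]_d :=
  (v ord0 ord0, rsubmx v).

Lemma cons_rVK d : cancel (@cons_rV d) (@uncons_rV d).
Proof.
move=> [x v]; rewrite /uncons_rV /cons_rV row_mxKr; congr pair => /=.
rewrite mxE; case: (fintype.split _) (splitK (ord0 : 'I_(1 + d))) => j.
  by rewrite mxE.
by move=> /(congr1 val).
Qed.

Lemma measurable_cons_rV d : measurable_fun setT (@cons_rV d).
Proof.
apply: measurable_fun_rV => i; rewrite -(splitK i).
case: (fintype.split i) => j /=.
  rewrite (_ : (fun _ => _) = fst)//.
  by apply/funext => t; rewrite row_mxEl mxE.
rewrite (_ : (fun _ => _) = (fun v : 'rV[R]_d => v ord0 j) \o snd); last first.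
  by apply/funext => t /=; rewrite row_mxEr.
by apply: measurableT_comp => //; exact: measurable_coord_rV.
Qed.

Lemma measurable_uncons_rV d : measurable_fun setT (@uncons_rV d).
Proof.
apply/measurable_fun_pair; first exact: measurable_coord_rV.
apply: measurable_fun_rV => i /=.
rewrite (_ : (fun _ => _) = (fun v : 'rV[R]_(1 + d) => v ord0 (rshift 1 i))).
  exact: measurable_coord_rV.
by apply/funext => t; rewrite mxE.
Qed.

Section step.
Context (d : nat) (mu : {sigma_finite_measure set 'rV[R]_d -> \bar R}).

Definition lebesgue_rV_step : set 'rV[R]_(1 + d) -> \bar R :=
  pushforward (@lebesgue_measure R \x mu)%E (@cons_rV d).

Let preimage_cons_rV A : measurable A -> measurable (@cons_rV d @^-1` A).
Proof.
by move=> mA; rewrite -[X in measurable X]setTI; exact: measurable_cons_rV.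
Qed.

Let lebesgue_rV_step0 : lebesgue_rV_step set0 = 0%E.
Proof. by rewrite /lebesgue_rV_step /pushforward preimage_set0 measure0. Qed.

Let lebesgue_rV_step_ge0 A : (0 <= lebesgue_rV_step A)%E.
Proof. by rewrite /lebesgue_rV_step /pushforward measure_ge0. Qed.

Let lebesgue_rV_step_sigma_additive : semi_sigma_additive lebesgue_rV_step.
Proof.
move=> F mF tF mUF; rewrite /lebesgue_rV_step /pushforward preimage_bigcup.
apply: measure_semi_sigma_additive.
- by move=> n; exact: preimage_cons_rV.
- apply/trivIsetP => /= i j _ _ ij; rewrite -preimage_setI.
  by move/trivIsetP : tF => /(_ _ _ _ _ ij) ->//; rewrite preimage_set0.
- by rewrite -preimage_bigcup; exact: preimage_cons_rV.
Qed.

HB.instance Definition _ := isMeasure.Build _ _ _ lebesgue_rV_step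
  lebesgue_rV_step0 lebesgue_rV_step_ge0 lebesgue_rV_step_sigma_additive.

Let lebesgue_rV_step_sigma_finite : sigma_finite setT lebesgue_rV_step.
Proof.
have /sigma_finiteP[F [TF ndF Foo]] := sigma_finiteT (@lebesgue_measure R).
have /sigma_finiteP[G [TG ndG Goo]] := sigma_finiteT mu.
exists (fun k => @uncons_rV d @^-1` (F k `*` G k)).
  apply/esym; rewrite -subTset => v _.
  have : (\bigcup_k F k) (uncons_rV v).1 by rewrite -TF.
  have : (\bigcup_k G k) (uncons_rV v).2 by rewrite -TG.
  move=> [m _ Gm] [n _ Fn]; exists (maxn m n) => //; split.
    by move: Fn; exact/subsetPset/ndF/leq_maxr.
  by move: Gm; exact/subsetPset/ndG/leq_maxl.
move=> k; have [mF Fk] := Foo k; have [mG Gk] := Goo k; split.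
  rewrite -[X in measurable X]setTI; apply: measurable_uncons_rV => //.
  exact: measurableX.
rewrite /lebesgue_rV_step /pushforward -comp_preimage.
have -> : @uncons_rV d \o @cons_rV d = id.
  by apply/funext => x /=; rewrite cons_rVK.
rewrite preimage_id product_measure1E//.
by rewrite lte_mul_pinfty// ge0_fin_numE.
Qed.

HB.instance Definition _ := Measure_isSigmaFinite.Build _ _ _
  lebesgue_rV_step lebesgue_rV_step_sigma_finite.
End step.

(* d-dimensional Lebesgue measure on the Borel sets of R^d, as an iterated
   product measure *)
Fixpoint lebesgue_rV d : {sigma_finite_measure set 'rV[R]_d -> \bar R} :=
  match d with
  | 0 => dirac (0 : 'rV[R]_0)
  | d'.+1 => lebesgue_rV_step (lebesgue_rV d')
  end.
End lebesgue_rV.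

(* LspaceType2 mu, the quotient of the square-integrable functions by almost
   everywhere equality, has no algebraic structure in the library: L2space mu
   is this type with its usual normed vector space structure *)
Section L2space.
Context d (T : measurableType d) (R : realType).
Variable mu : {measure set T -> \bar R}.

Local Notation Lfun2 := (LfunType mu (lee1n 2)).
Local Notation mfun_ae := {mfun_ mu, T >-> measurableTypeR R}.

Definition L2space : Type := LspaceType2 mu.
HB.instance Definition _ := gen_eqMixin L2space.
HB.instance Definition _ := gen_choiceMixin L2space.

Definition L2fun (u : L2space) : T -> R := (u : LspaceType2 mu).

Lemma Lnorm_ae (f g : T -> R) : measurable_fun setT f -> measurable_fun setT g ->
  f = g %[ae mu] -> 'N[mu]_2%:E [EFin \o f]%E = 'N[mu]_2%:E [EFin \o g]%E.
Proof.
have mpow (h : T -> R) : measurable_fun setT h ->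
    measurable_fun setT (fun x => `|(EFin \o h) x| `^ 2)%E.
  move=> /measurable_EFinP mh.
  apply: (@measurableT_comp _ _ _ _ _ _ (fun x : \bar R => x `^ 2)%E _ (abse \o (EFin \o h))).
    exact: measurable_poweR.
  exact: measurableT_comp.
move=> mf mg fg; rewrite unlock; congr (_ `^ _)%E.
apply: ge0_ae_eq_integral => //; [exact: mpow|exact: mpow| | |].
- by move=> x _; exact: poweR_ge0.
- by move=> x _; exact: poweR_ge0.
by apply: filterS fg => x /= + xD => /(_ xD) ->.
Qed.


Lemma measurable_L2fun (u : L2space) : measurable_fun setT (L2fun u).
Proof.
have mr := @measurable_funPT _ _ _ _ (repr (LebesgueSpace.sort u) : {mfun T >-> measurableTypeR R}).
by move=> _ A mA; exact: mr.
Qed.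

Lemma L2fun_in (u : L2space) : L2fun u \in Lfun mu 2%:E.
Proof.
rewrite inE; apply/andP; split; rewrite inE/=; first exact: measurable_L2fun.
exact: Lebesgue_finite.
Qed.

Definition L2rep (u : L2space) : Lfun2 := Lfun_Sub (lee1n 2) (L2fun_in u).

Section L2class.
Variable f : Lfun2.

Let g : T -> measurableTypeR R := f.
Let mg : measurable_fun setT g.
Proof. by move=> _ A mA; exact: (@measurable_funPT _ _ _ _ f). Qed.
HB.instance Definition _ := @isMeasurableFun.Build _ _ _ _ g mg.

Definition L2class_mfun : mfun_ae := (\pi_(mfun_ae) (g : {mfun T >-> measurableTypeR R}))%qT.

Lemma L2class_mfunE : (L2class_mfun : T -> R) = f %[ae mu].
Proof.
have := reprK L2class_mfun.
rewrite {2}/L2class_mfun => /eqmodP/asboolP.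
exact.
Qed.

Lemma L2class_finite : finite_norm mu 2%:E L2class_mfun.
Proof.
rewrite /finite_norm (@Lnorm_ae _ f)//.
- exact: Lfunction_finite.
- have mr := @measurable_funPT _ _ _ _ (repr L2class_mfun : {mfun T >-> measurableTypeR R}).
  by move=> _ A mA; exact: mr.
- exact: L2class_mfunE.
Qed.

HB.instance Definition _ := @isFinLebesgue.Build d T R mu 2%:E (lee1n 2)
  L2class_mfun L2class_finite.

Definition L2class : L2space := (L2class_mfun : LspaceType mu (lee1n 2)).

End L2class.

Lemma L2repE (f : Lfun2) : L2rep (L2class f) = f %[ae mu].
Proof. exact: L2class_mfunE. Qed.

Lemma L2space_eqP (u v : L2space) : u = v <-> L2fun u = L2fun v %[ae mu].
Proof.
split=> [->|]; first exact: ae_eq_refl.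
move: u v => [u [[fu]]] [v [[fv]]] /= uv.
have {}uv : u = v.
  by rewrite -[u]reprK -[v]reprK; apply/eqmodP/asboolP; exact: uv.
by move: fu fv; rewrite uv => fu fv; rewrite (Prop_irrelevance fu fv).
Qed.

Lemma L2class_eq (f g : Lfun2) : f = g %[ae mu] -> L2class f = L2class g.
Proof.
move=> fg; apply/L2space_eqP.
apply: ae_eq_trans (L2class_mfunE f) _; apply: (ae_eq_trans fg).
by apply: ae_eq_sym; exact: L2class_mfunE.
Qed.

Lemma L2repK : cancel L2rep L2class.
Proof. by move=> u; apply/L2space_eqP; exact: L2class_mfunE. Qed.

Definition L2zero : L2space := L2class 0.
Definition L2opp (u : L2space) : L2space := L2class (- L2rep u).
Definition L2add (u v : L2space) : L2space := L2class (L2rep u + L2rep v).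
Definition L2scale (a : R) (u : L2space) : L2space := L2class (a *: L2rep u).
Definition L2norm (u : L2space) : R := fine ('N[mu]_2%:E [EFin \o L2fun u])%E.

Let oppE f : L2opp (L2class f) = L2class (- f).
Proof.
apply: L2class_eq; apply: filterS (L2repE f) => x /(_ I) fx _.
exact: (congr1 -%R fx).
Qed.

Let addE f g : L2add (L2class f) (L2class g) = L2class (f + g).
Proof.
apply: L2class_eq; apply: filterS2 (L2repE f) (L2repE g) => x /(_ I) fx /(_ I) gx _.
exact: (congr2 +%R fx gx).
Qed.

Let scaleE a f : L2scale a (L2class f) = L2class (a *: f).
Proof.
apply: L2class_eq; apply: filterS (L2repE f) => x /(_ I) fx _.
exact: (congr1 ( *%R a) fx).
Qed.

Let L2ind (P : L2space -> Prop) : (forall f, P (L2class f)) -> forall u, P u.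
Proof. by move=> Pf u; rewrite -(L2repK u). Qed.

Let L2addA : associative L2add.
Proof. by elim/L2ind=> f; elim/L2ind=> g; elim/L2ind=> h; rewrite !addE addrA. Qed.

Let L2addC : commutative L2add.
Proof. by elim/L2ind=> f; elim/L2ind=> g; rewrite !addE addrC. Qed.

Let L2add0 : left_id L2zero L2add.
Proof. by elim/L2ind=> f; rewrite addE add0r. Qed.

Let L2addN : left_inverse L2zero L2opp L2add.
Proof. by elim/L2ind=> f; rewrite oppE addE addNr. Qed.

HB.instance Definition _ :=
  GRing.isZmodule.Build L2space L2addA L2addC L2add0 L2addN.

Let L2scaleA a b v : L2scale a (L2scale b v) = L2scale (a * b) v.
Proof. by elim/L2ind: v => f; rewrite !scaleE scalerA. Qed.

Let L2scale1 : left_id 1 L2scale.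
Proof. by elim/L2ind=> f; rewrite scaleE scale1r. Qed.

Let L2scaleDr : right_distributive L2scale +%R.
Proof.
move=> a; elim/L2ind=> f; elim/L2ind=> g.
rewrite -[RHS]/(L2add _ _) -[X in L2scale a X]/(L2add _ _).
by rewrite addE !scaleE addE scalerDr.
Qed.

Let L2scaleDl v : {morph L2scale^~ v : a b / a + b}.
Proof.
elim/L2ind: v => f a b; rewrite -[RHS]/(L2add _ _).
by rewrite !scaleE addE scalerDl.
Qed.

HB.instance Definition _ := GRing.Zmodule_isLmodule.Build R L2space
  L2scaleA L2scale1 L2scaleDr L2scaleDl.

Let L2norm_class f : L2norm (L2class f) = fine ('N[mu]_2%:E [EFin \o f])%E.
Proof.
congr fine; apply: Lnorm_ae; last exact: L2class_mfunE.
  exact: measurable_L2fun.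
exact: measurable_funPT.
Qed.

Let L2normD u v : L2norm (u + v) <= L2norm u + L2norm v.
Proof.
elim/L2ind: u => f; elim/L2ind: v => g.
by rewrite -[_ + _]/(L2add _ _) addE !L2norm_class ler_LnormD.
Qed.

Let L2normZ a u : L2norm (a *: u) = `|a| * L2norm u.
Proof.
elim/L2ind: u => f; rewrite -[_ *: _]/(L2scale _ _) scaleE !L2norm_class.
by apply/EFin_inj; rewrite EFinM !finite_norm_fine -LnormZ.
Qed.

Let L2norm0_eq0 u : L2norm u = 0 -> u = 0.
Proof.
elim/L2ind: u => f; rewrite L2norm_class => /fine_Lnormr_eq0 f0.
exact: L2class_eq.
Qed.

HB.instance Definition _ := Lmodule_isNormed.Build R L2space
  L2normD L2normZ L2norm0_eq0.

Definition L2inner (u v : L2space) : R := \int[mu]_x (L2fun u x * L2fun v x).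

End L2space.
Arguments L2class {d T R mu} f.

Section domains.
Context (R : realType) (d : nat).
Implicit Types (U Omega : set 'rV[R]_d) (g : 'rV[R]_d -> R).

Definition partial (i : 'I_d) g : 'rV[R]_d -> R :=
  fun x => 'D_(delta_mx ord0 i) g x.

Definition laplacian g : 'rV[R]_d -> R :=
  fun x => \sum_(i < d) partial i (partial i g) x.

(* g is of class C^k on U; only meant for open U *)
Fixpoint class_C k U g : Prop :=
  (forall x, U x -> {for x, continuous g}) /\
  match k with
  | 0 => True
  | k'.+1 => forall i : 'I_d,
      (forall x, U x -> derivable g x (delta_mx ord0 i)) /\
      class_C k' U (partial i g)
  end.

(* For open sets only: the boundary is closure Omega `\` Omega *)
Definition boundary Omega : set 'rV[R]_d := closure Omega `\` Omega.

(* Near each boundary point, Omega is the sublevel set {g < 0} of a C^oo function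
   with nonvanishing gradient; hence the boundary is a C^oo hypersurface with
   Omega locally on one side *)
Definition smooth_boundary Omega : Prop :=
  forall x, boundary Omega x -> exists U g,
    [/\ open U, U x, forall k, class_C k U g, exists i, partial i g x != 0 &
        Omega `&` U = [set y | g y < 0] `&` U].

Record smooth_domain := SmoothDomain {
  dom :> set 'rV[R]_d ;
  dom_nonempty : dom !=set0 ;
  dom_open : open dom ;
  dom_connected : connected dom ;
  dom_bounded : bounded_set dom ;
  dom_smooth_boundary : smooth_boundary dom }.

Lemma measurable_dom (Omega : smooth_domain) : measurable (Omega : set 'rV[R]_d).
Proof. by apply: open_measurable_rV; exact: dom_open. Qed.

Definition lebesgue_on (Omega : smooth_domain) :
    {measure set 'rV[R]_d -> \bar R} :=
  mrestr (lebesgue_rV R d) (measurable_dom Omega).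

Definition L2 (Omega : smooth_domain) : normedModType R :=
  L2space (lebesgue_on Omega).

Definition dirichlet_eigenfunction Omega (l : R) g : Prop :=
  [/\ class_C 2 Omega g,
      {within closure Omega, continuous g},
      forall x, boundary Omega x -> g x = 0 &
      forall x, Omega x -> - laplacian g x = l * g x].

End domains.

Section eigenbasis.
Context (R : realType) (d : nat) (Omega : smooth_domain R d).

Definition orthonormal_basis (phi : nat -> L2 Omega) : Prop :=
  (forall i j, L2inner (phi i) (phi j) = (i == j)%:R) /\
  dense [set w | exists n (a : nat -> R), w = \sum_(i < n) a i *: phi i].

(* Indices start at 0: lam n and phi n are the (n+1)-st eigenvalue and
   eigenfunction, and lam 0 is the principal eigenvalue *)
Definition dirichlet_eigenbasis (lam : nat -> R) (phi : nat -> L2 Omega) : Prop :=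
  [/\ orthonormal_basis phi,
      0 < lam 0%N,
      {homo lam : m n / (m <= n)%N >-> m <= n},
      lam @ \oo --> +oo &
      forall n, exists2 g, dirichlet_eigenfunction Omega (lam n) g &
        L2fun (phi n) = g %[ae lebesgue_on Omega]].

End eigenbasis.

Section relaxation.
Context (R : realType).

Definition Gamma (b : R) : R :=
  \int[lebesgue_measure]_(x in `]0, +oo[) (x `^ (b - 1) * expR (- x)).

Definition gker (b t : R) : R := t `^ (b - 1) / Gamma b.

(* omega t mu is, for each mu > 0, the continuous solution on [0, +oo[ of
   omega' + mu (1 + gamma D^alpha) omega = 0, omega(0) = 1, where D^alpha is the
   Riemann-Liouville derivative, in integrated (Volterra) form *)
Definition relaxation_function (gamma alpha : R) (omega : R -> R -> R) : Prop :=
  forall mu, 0 < mu ->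
    {within `[0, +oo[, continuous (omega ^~ mu)} /\
    forall t, 0 <= t ->
      omega t mu + mu * \int[lebesgue_measure]_(s in `[0, t])
        ((1 + gamma * gker (1 - alpha) (t - s)) * omega s mu) = 1.

End relaxation.

(* Riemann integral over [a, b], a <= b, of a vector-valued function: limit of the
   Riemann sums over tagged partitions a = x 0 <= y 0 <= x 1 <= ... <= x n = b as
   the mesh tends to 0. It is the Bochner integral for continuous F *)
Definition is_Rintegral (R : realType) (V : normedModType R) (F : R -> V)
    (a b : R) (I : V) : Prop :=
  forall e, 0 < e -> exists2 delta, 0 < delta &
    forall n (x y : nat -> R), x 0%N = a -> x n = b ->
      (forall i, (i < n)%N ->
        [/\ x i <= y i, y i <= x i.+1 & x i.+1 - x i < delta]) ->
      `| \sum_(i < n) (x i.+1 - x i) *: F (y i) - I | < e.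

Section mild_solutions.
Context (R : realType) (d : nat) (Omega : smooth_domain R d).
Variables (omega : R -> R -> R) (lam : nat -> R) (phi : nat -> L2 Omega).
Variables (tau : R) (rho : R -> R) (f : R -> L2 Omega -> L2 Omega).

Definition resolvent (t : R) (v : L2 Omega) : L2 Omega :=
  limn (fun N => \sum_(n < N) (omega t (lam n) * L2inner v (phi n)) *: phi n).

(* Functions on [-tau, 0] and on [-tau, +oo[ are represented by functions on R,
   whose values outside these intervals are irrelevant *)
Definition mild_solution (xi u : R -> L2 Omega) : Prop :=
  [/\ {within `[- tau, +oo[, continuous u},
      forall s, - tau <= s <= 0 -> u s = xi s &
      forall t, 0 <= t -> exists2 I : L2 Omega,
        is_Rintegral (fun s => resolvent (t - s) (f s (u (s - rho s)))) 0 t I &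
        u t = resolvent t (xi 0) + I].

Definition history_norm (xi : R -> L2 Omega) : R :=
  sup [set `|xi s| | s in `[- tau, 0]].

Definition zero_asymptotically_stable : Prop :=
  exists2 delta0, 0 < delta0 &
    (forall xi, {within `[- tau, 0], continuous xi} ->
      history_norm xi <= delta0 ->
      (exists u, mild_solution xi u) /\
      (forall u, mild_solution xi u -> `|u t| @[t --> +oo] --> (0 : R))) /\
    (forall eps, 0 < eps -> exists2 delta, 0 < delta <= delta0 &
      forall xi, {within `[- tau, 0], continuous xi} ->
        history_norm xi <= delta ->
        forall u, mild_solution xi u -> forall t, 0 <= t -> `|u t| <= eps).

End mild_solutions.

Section halfline.
Context (R : realType).

Lemma halfline_measurable :
  measurable (`[0, +oo[%classic : set (measurableTypeR R)).
Proof. exact: measurable_itv. Qed.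

Definition halfline_measure : {measure set (measurableTypeR R) -> \bar R} :=
  mrestr (@lebesgue_measure R) halfline_measurable.

Definition Linfty_norm (p : R -> R) : \bar R :=
  'N[halfline_measure]_+oo [EFin \o p]%E.

Definition in_Linfty (p : R -> R) : Prop :=
  measurable_fun (`[0, +oo[%classic : set R) p /\ (Linfty_norm p < +oo)%E.

End halfline.

(* Main.v *)
From HB Require Import structures.
Require Import Defs.
From mathcomp Require Import all_boot all_order all_algebra.
From mathcomp Require Import all_classical all_reals all_analysis.
From mathcomp Require Import measurable_realfun ess_sup_inf ring lra.
Set Implicit Arguments. Unset Strict Implicit. Unset Printing Implicit Defensive.
Import Order.TTheory GRing.Theory Num.Theory.
Import numFieldNormedType.Exports.
Local Open Scope classical_set_scope.
Local Open Scope ring_scope.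

(* The kernel k(x) = 1 + c x^-alpha is nonincreasing and log-convex. A first-zero
   argument for Volterra equations w + k * w = G then shows, for suitable right-hand
   sides G, that the relaxation functions are positive, nonincreasing in time and
   nonincreasing in the parameter mu. Hence the resolvent S(t) has norm at most
   omega(t, lambda_1), and omega(., lambda_1) has integral at most 1 / lambda_1.
   Near 0 the nonlinearity is Lipschitz with a constant M < lambda_1, so that the
   integral equation is a contraction with ratio q = M / lambda_1, globally in time,
   for the sup norm. This gives existence; a continuity argument keeps every small
   solution in the ball where the Lipschitz bound holds; and since the delayed time
   tends to infinity, an eventual bound B on the norm of u improves to (1 + q) B / 2. *)

(** * Volterra equations *)

(** The relaxation functions are accessible only through an integrated equation whose kernel is
    singular at 0, so every sign statement is drawn from one comparison principle rather than from
    differential inequalities. Its hypothesis [G t * k (t' - s) <= G t' * k (t - s)] says that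
    between two times the right-hand side shrinks by no larger a factor than the kernel does.
    Positive nondecreasing functions satisfy it because [k] is nonincreasing; translates of [k]
    satisfy it because [k] is log-convex. Positivity and the comparison of parameters use the first
    kind, monotonicity in time the second. The resolvent has memory and obeys no semigroup law: its
    decay enters only through the bounds [1 / lambda_1] on the integral of its norm and
    [1 / (lambda_1 * t)] on the norm itself. The delayed time tends to infinity at no prescribed
    rate, so decay of [u] comes from iterating a contraction of eventual bounds, with no rate. The
    bound on [p] holds almost everywhere only; continuity of [f] in time carries the Lipschitz
    estimate to every time. *)

Section reflection.
Context {R : realType}.
Local Notation mu := (@lebesgue_measure R).

Lemma preimage_reflect (t a b : R) b0 b1 :
  (fun s => t - s) @^-1` [set` Interval (BSide b0 a) (BSide b1 b)] =
  [set` Interval (BSide (~~ b1) (t - b)) (BSide (~~ b0) (t - a))].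
Proof.
apply/seteqP; split=> s /=; rewrite !in_itv/=.
  by case: b0; case: b1 => /= /andP[? ?]; apply/andP; split; lra.
by case: b0; case: b1 => /= /andP[? ?]; apply/andP; split; lra.
Qed.

Lemma measurable_reflect (t : R) : measurable_fun setT (fun s : R => t - s).
Proof. exact: measurable_funB. Qed.

(** Half-open intervals determine the measure, and reflection sends []a, b]] to [[t - b, t - a[],
    which has the same length. *)
Lemma lebesgue_measure_reflect (t : R) (A : set R) : measurable A ->
  pushforward mu ((fun s => t - s) : measurableTypeR R -> measurableTypeR R) A = mu A.
Proof.
move=> mA; apply/esym.
pose f : {mfun measurableTypeR R >-> measurableTypeR R} :=
  HB.pack (fun s : R => t - s)
    (@isMeasurableFun.Build _ _ (measurableTypeR R) (measurableTypeR R)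
      (fun s : R => t - s) (measurable_reflect t)).
apply: (@lebesgue_measure_unique _ (pushforward mu f)) => //= _ [[a b]] _ <-.
rewrite /pushforward preimage_reflect/= !lebesgue_measure_itv/= !lte_fin.
have -> : (t - b < t - a) = (a < b) by apply/idP/idP; lra.
by case: ifP => // _; rewrite -!EFinD; congr (_%:E); lra.
Qed.

Lemma ge0_integral_reflect (t : R) (D : set R) (f : R -> \bar R) :
  measurable D -> measurable_fun D f -> (forall y, D y -> 0 <= f y)%E ->
  (\int[mu]_(y in D) f y = \int[mu]_(s in (fun s => t - s)%R @^-1` D) f (t - s)%R)%E.
Proof.
move=> mD mf f0.
rewrite -(@ge0_integral_pushforward _ _ (measurableTypeR R) (measurableTypeR R) R
  (fun s => t - s) (measurable_reflect t) mu D f)//.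
- apply: eq_measure_integral => [|mr A mA _]; first exact: measurable_reflect.
  exact/esym/lebesgue_measure_reflect.
- by move=> y /[!inE]; exact: f0.
Qed.

End reflection.

Section first_zero.
Context {R : realType}.

Lemma first_nonpos (w : R -> R) (t1 : R) : continuous w -> 0 < w 0 ->
  0 <= t1 -> w t1 <= 0 ->
  exists t0 : R, [/\ 0 < t0, w t0 <= 0 & forall s : R, 0 <= s < t0 -> 0 < w s].
Proof.
move=> cw w0 t1_ge0 wt1.
pose Z := [set t | 0 <= t /\ w t <= 0].
have Z0 : Z !=set0 by exists t1.
have Zlb : has_lbound Z by exists 0 => t [].
pose t0 := inf Z.
have t0_ge0 : 0 <= t0 by apply: lb_le_inf => // t [].
have wt0 : w t0 <= 0.
  rewrite leNgt; apply/negP => wt0.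
  have /nbhs_ballP[e /= e0 we] : \forall x \near t0, 0 < w x.
    by move: (cw t0) => /cvgr_gt; apply.
  have [z [z0 wz] zt0] := @inf_adherent _ Z e e0 (conj Z0 Zlb).
  have t0z : t0 <= z by exact: (ge_inf Zlb).
  have : 0 < w z.
    by apply: we; rewrite /ball/= ltr_distlC; apply/andP; split; [lra|].
  by lra.
exists t0; split => //.
  rewrite lt_neqAle t0_ge0 andbT; apply/eqP => t00.
  by move: wt0 w0; rewrite -t00 => ? ?; lra.
move=> s /andP[s0 st0]; rewrite ltNge; apply/negP => ws.
have : t0 <= s by exact: (ge_inf Zlb).
by lra.
Qed.

End first_zero.

Section Rintegral_ext.
Context {R : realType}.
Local Notation mu := (@lebesgue_measure R).

Lemma integrable_scale (D : set R) (f : R -> R) (r : R) : measurable D ->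
  mu.-integrable D (EFin \o f) -> mu.-integrable D (EFin \o (fun x => r * f x)).
Proof.
move=> mD fi; rewrite (_ : _ \o _ = (fun x => r%:E * (EFin \o f) x)%E).
  exact: integrableZl.
by apply/funext => x /=; rewrite EFinM.
Qed.

Lemma subset_Rintegral (A B : set R) (f : R -> R) : measurable A -> measurable B ->
  A `<=` B -> mu.-integrable B (EFin \o f) -> (forall x, B x -> 0 <= f x) ->
  \int[mu]_(x in A) f x <= \int[mu]_(x in B) f x.
Proof.
move=> mA mB AB iB f0; rewrite /Rintegral fine_le//.
- by apply: integrable_fin_num => //; exact: integrableS iB.
- exact: integrable_fin_num.
- by apply: ge0_subset_integral => //; exact: measurable_int iB.
Qed.

End Rintegral_ext.

Section volterra.
Context {R : realType}.
Local Notation mu := (@lebesgue_measure R).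
Context (k : R -> R).
Hypothesis k_ge0 : forall x, 0 <= k x.
Hypothesis k_int : forall t : R, 0 <= t ->
  mu.-integrable `[0, t] (EFin \o (fun s => k (t - s))).

Lemma integrable_volterra t (w : R -> R) : 0 <= t -> continuous w ->
  mu.-integrable `[0, t] (EFin \o (fun s => k (t - s) * w s)).
Proof.
move=> t0 cw; apply: (@integrableMl _ _ _ mu `[0, t] _ (EFin \o (fun s => k (t - s))) w) => //.
- exact: k_int.
- by apply: measurable_funTS; exact: continuous_measurable_fun.
- have cw' : {within `[0, t], continuous w} by apply: continuous_subspaceT.
  have /compact_bounded[M [_ mrt]] := continuous_compact cw' (@segment_compact _ 0 t).
  by exists M; split; rewrite ?num_real // => ? ? ? ?; exact: mrt.
Qed.

(* At a first zero t0, compare the equation at t0 with the one at the maximum point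
   t* of w on a short interval [x, t0]: the history before t* contributes with a
   favourable sign, so w t* is at most a small multiple of itself. *)
Lemma volterra_gt0 (w G : R -> R) : continuous w -> 0 < w 0 ->
  (forall t : R, 0 <= t -> w t + \int[mu]_(s in `[0, t]) (k (t - s) * w s) = G t) ->
  (forall t : R, 0 <= t -> 0 < G t) ->
  (forall T : R, 0 <= T -> exists C : R, forall t : R, 0 <= t <= T -> G t <= C) ->
  (forall s t t' : R, 0 <= s -> s < t -> t <= t' ->
    G t * k (t' - s) <= G t' * k (t - s)) ->
  forall t : R, 0 <= t -> 0 < w t.
Proof.
move=> cw w0 eqw G0 Gbnd Gk t1 t1_ge0; rewrite ltNge; apply/negP => wt1.
have [t0 [t0_gt0 wt0 wpos]] := first_nonpos cw w0 t1_ge0 wt1.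
have t0_ge0 := ltW t0_gt0.
have [C GC] := Gbnd _ t0_ge0.
have Gt0 := G0 _ t0_ge0.
have C0 : 0 < C by apply: (lt_le_trans Gt0); apply: GC; rewrite t0_ge0 lexx.
pose K (x : R) := \int[mu]_(s in `]x, t0]) k (t0 - s).
(* The kernel has small mass near its singularity. The threshold [G t0 / C] is the one for which the
   final chain closes, since [G t' <= C]. *)
have [x /andP[x0 xt0] Kx] : exists2 x : R, 0 < x < t0 & K x < G t0 / C.
  have e0 : 0 < G t0 / C by rewrite divr_gt0.
  have /cvgrPdist_lt /(_ _ e0) near_t0 :=
    parameterized_integral_cvg_at_left t0_gt0 (k_int t0_ge0).
  near (t0^'-) => x.
  exists x; first by apply/andP; split; near: x; [exact: nbhs_left_gt|exact: nbhs_left_lt].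
  have x0 : 0 <= x by near: x; apply: nbhs_left_ge.
  have xt0 : x <= t0 by near: x; apply: nbhs_left_le.
  have : `|parameterized_integral mu 0 t0 (fun s => k (t0 - s)) -
           parameterized_integral mu 0 x (fun s => k (t0 - s))| < G t0 / C by near: x.
  rewrite /parameterized_integral (Rintegral_itvB (k_int t0_ge0)) ?bnd_simp//.
  by move=> /(le_lt_trans (ler_norm _)).
have [t' /[!in_itv]/= /andP[xt' t't0] wmax] :=
  EVT_max (ltW xt0) (continuous_subspaceT cw).
have t'0 : 0 < t' by apply: lt_le_trans xt'.
have wt' : 0 < w t'.
  apply: (@lt_le_trans _ _ (w x)); last by apply: wmax; rewrite in_itv/= lexx ltW.
  by apply: wpos; rewrite ltW.
have {}t't0 : t' < t0.
  by rewrite lt_neqAle t't0 andbT; apply/eqP => E; move: wt' wt0; rewrite E; lra.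
have Gt' := G0 _ (ltW t'0).
have i0 := integrable_volterra t0_ge0 cw.
have i1 := integrable_volterra (ltW t'0) cw.
have sub1 : `[0, t'[ `<=` `[0, t0].
  by apply: subset_itvl; rewrite bnd_simp ltW.
have i0' : mu.-integrable `[0, t'[ (EFin \o (fun s => k (t0 - s) * w s)).
  exact: integrableS i0.
have i1' : mu.-integrable `[0, t'[ (EFin \o (fun s => k (t' - s) * w s)).
  by apply: integrableS i1 => //; apply: subset_itvl; rewrite bnd_simp.
pose A0 := \int[mu]_(s in `[0, t'[) (k (t0 - s) * w s).
pose A1 := \int[mu]_(s in `[0, t'[) (k (t' - s) * w s).
pose B := \int[mu]_(s in `]t', t0]) (k (t0 - s) * w s).
have eq0 : w t0 + (A0 + B) = G t0.
  rewrite -(eqw _ t0_ge0); congr (_ + _).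
  rewrite /A0 Rintegral_itv_bndo_bndc//.
  have := Rintegral_itvB i0 (_ : BLeft 0 <= BRight t')%O (_ : BRight t' <= BRight t0)%O.
  by rewrite !bnd_simp => /(_ (ltW t'0) (ltW t't0)); rewrite -/B; lra.
have eq1 : w t' + A1 = G t' by rewrite -(eqw _ (ltW t'0)) /A1 Rintegral_itv_bndo_bndc.
(* The hypothesis [Gk] at the times [t' <= t0], integrated against [w], which is positive before
   [t']. *)
have A01 : G t' * A0 <= G t0 * A1.
  rewrite /A0 /A1 -!RintegralZl//; apply: le_Rintegral => //.
  - exact: integrable_scale.
  - exact: integrable_scale.
  move=> s /=; rewrite in_itv/= => /andP[s0 st'].
  rewrite !mulrA ler_wpM2r//; first by rewrite ltW// wpos// s0 (lt_trans st').
  exact: Gk (ltW t't0).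
have sub2 : `]t', t0] `<=` `[0, t0].
  by apply: subset_itvr; rewrite bnd_simp ltW.
have ik2 : mu.-integrable `]t', t0] (EFin \o (fun s => k (t0 - s))).
  exact: integrableS (k_int t0_ge0).
have BK : B <= w t' * K t'.
  rewrite /B /K -RintegralZl//; apply: le_Rintegral => //.
  - exact: integrableS i0.
  - exact: integrable_scale.
  move=> s /=; rewrite in_itv/= => /andP[s0 st'].
  rewrite mulrC ler_wpM2r//; apply: wmax; rewrite in_itv/= st' andbT.
  by rewrite (le_trans xt')// ltW.
have KK : K t' <= K x.
  apply: subset_Rintegral => //; first by apply: subset_itvr; rewrite bnd_simp.
  by apply: integrableS (k_int t0_ge0) => //; apply: subset_itvr; rewrite bnd_simp ltW.
have K0 : 0 <= K t' by apply: Rintegral_ge0.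
have B' : B < w t' * (G t0 / C).
  by apply: (le_lt_trans BK); rewrite ltr_pM2l// (le_lt_trans KK).
(* Cross-multiplying the equations at [t0] and [t'] by [G t'] and [G t0] eliminates the product
   [G t0 * G t']; then [A01] and [w t0 <= 0] remove everything but [B]. *)
have : G t0 * w t' <= G t' * B.
  have h1 : G t' * w t0 <= 0 by rewrite mulr_ge0_le0// ltW.
  have -> : G t0 * w t' = G t0 * G t' - G t0 * A1 by rewrite -eq1; ring.
  have : G t' * G t0 = G t' * w t0 + G t' * A0 + G t' * B by rewrite -eq0; ring.
  by lra.
have : G t' * B < C * (w t' * (G t0 / C)).
  have GC' : G t' <= C by apply: GC; rewrite !ltW.
  apply: (@lt_le_trans _ _ (G t' * (w t' * (G t0 / C)))); first by rewrite ltr_pM2l.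
  by rewrite ler_wpM2r// mulr_ge0// ?divr_ge0// ltW.
have -> : C * (w t' * (G t0 / C)) = G t0 * w t' by field; rewrite gt_eqF.
by move=> ? ?; lra.
Unshelve. all: by end_near.
Qed.

End volterra.

(** * Relaxation functions *)

Section shift.
Context {R : realType}.
Local Notation mu := (@lebesgue_measure R).

(** A translation is the composite of the two reflections [s |-> h - s] and [s |-> 0 - s]. *)
Lemma ge0_Rintegral_shift (a b h : R) (f : R -> R) :
  measurable_fun setT f -> (forall y, a + h <= y <= b + h -> 0 <= f y) ->
  \int[mu]_(y in `[a + h, b + h]) f y = \int[mu]_(s in `[a, b]) f (s + h).
Proof.
move=> mf f0; congr fine.
rewrite (@ge0_integral_reflect _ h)//=; last first.
  by apply/measurable_EFinP; exact: measurable_funTS.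
rewrite preimage_reflect/= (@ge0_integral_reflect _ 0)//=; last 2 first.
- apply/measurable_EFinP; apply: measurable_funTS.
  by apply: measurableT_comp => //; exact: measurable_reflect.
- move=> y; rewrite in_itv/= lee_fin => yab; apply: f0.
  by move: yab => /andP[? ?]; apply/andP; split; lra.
rewrite preimage_reflect/=.
have -> : 0 - (h - (a + h)) = a by ring.
have -> : 0 - (h - (b + h)) = b by ring.
by apply: eq_integral => s _; congr (f _)%:E; ring.
Qed.

End shift.

Section relaxation_kernel.
Context {R : realType}.
Local Notation mu := (@lebesgue_measure R).
Context (k : R -> R).
Hypothesis k_meas : measurable_fun setT k.
Hypothesis k_ge1 : forall x, 1 <= k x.
Hypothesis k_le : forall x y : R, 0 < x -> x <= y -> k y <= k x.
Hypothesis k_logconvex : forall x y h : R, 0 < x -> x <= y -> 0 <= h ->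
  k y * k (x + h) <= k (y + h) * k x.
Hypothesis k_int : forall t : R, 0 <= t ->
  mu.-integrable `[0, t] (EFin \o (fun s => k (t - s))).

(** Continuity is global: a relaxation function on the half-line enters after being frozen at its
    value at 0 for negative times. *)
Definition volterra_relaxation (m : R) (w : R -> R) :=
  continuous w /\
  forall t : R, 0 <= t -> w t + m * \int[mu]_(s in `[0, t]) (k (t - s) * w s) = 1.

Let k_ge0 x : 0 <= k x. Proof. exact: le_trans (k_ge1 x). Qed.

Let volterra_scale_gt0 (m : R) (w G : R -> R) : 0 < m -> continuous w -> 0 < w 0 ->
  (forall t : R, 0 <= t -> w t + m * \int[mu]_(s in `[0, t]) (k (t - s) * w s) = G t) ->
  (forall t : R, 0 <= t -> 0 < G t) ->
  (forall T : R, 0 <= T -> exists C, forall t : R, 0 <= t <= T -> G t <= C) ->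
  (forall s t t' : R, 0 <= s -> s < t -> t <= t' ->
    G t * k (t' - s) <= G t' * k (t - s)) ->
  forall t : R, 0 <= t -> 0 < w t.
Proof.
move=> m0 cw w0 eqw G0 GC Gk.
apply: (@volterra_gt0 _ (fun x => m * k x) _ _ w G) => //.
- by move=> x; rewrite mulr_ge0// ltW.
- by move=> t t0; apply: integrable_scale => //; exact: k_int.
- move=> t t0; rewrite -eqw// -RintegralZl//; last exact: integrable_volterra.
  by congr (_ + _); apply: eq_Rintegral => s _; rewrite mulrA.
- move=> s t t' s0 st tt'; rewrite !(mulrCA _ m) ler_pM2l//; exact: Gk.
Qed.

(** * Positivity, monotonicity and integral bounds for a fixed parameter *)

Section one_parameter.
Context (m : R) (w : R -> R).
Hypothesis m_gt0 : 0 < m.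
Hypothesis w_rel : volterra_relaxation m w.

Let cw := w_rel.1.
Let eqw := w_rel.2.

Lemma relaxation0 : w 0 = 1.
Proof. by rewrite -(eqw (lexx 0)) set_itv1 Rintegral_set1 mulr0 addr0. Qed.

(** For a constant right-hand side, the comparison hypothesis is exactly monotonicity of the
    kernel. *)
Lemma relaxation_gt0 t : 0 <= t -> 0 < w t.
Proof.
move: t; apply: (@volterra_scale_gt0 m w (cst 1)) => //.
- by rewrite relaxation0.
- by move=> T _; exists 1.
- move=> s t t' s0 st tt'; rewrite !mul1r; apply: k_le; first by rewrite subr_gt0.
  by rewrite lerD2r.
Qed.

Let w_itv_ge0 t s : s \in `[0, t] -> 0 <= w s.
Proof. by rewrite in_itv/= => /andP[s0 _]; rewrite ltW// relaxation_gt0. Qed.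

Let conv_ge0 t : 0 <= \int[mu]_(s in `[0, t]) (k (t - s) * w s).
Proof. by apply: Rintegral_ge0 => s /w_itv_ge0 ws; rewrite mulr_ge0. Qed.

Lemma relaxation_le1 t : 0 <= t -> w t <= 1.
Proof. by move=> t0; rewrite -(eqw t0) lerDl mulr_ge0// ltW. Qed.

Let iw t : mu.-integrable `[0, t] (EFin \o w).
Proof.
by apply: continuous_compact_integrable; [exact: segment_compact|exact: continuous_subspaceT].
Qed.

(** Since [k >= 1] and [w >= 0], the memory integral dominates the plain integral of [w]. *)
Lemma relaxation_integral t : 0 <= t -> m * \int[mu]_(s in `[0, t]) w s <= 1.
Proof.
move=> t0; rewrite -(eqw t0); apply: ler_wpDl; first exact/ltW/relaxation_gt0.
rewrite ler_pM2l//.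
apply: le_Rintegral => //; first exact: integrable_volterra.
by move=> s /w_itv_ge0 ws; rewrite ler_peMl.
Qed.

(** The memory of [[0, h]] that remains in the equation restarted at time [h]. *)
Let shifted_mass h t := \int[mu]_(s in `[0, h]) (k (t + h - s) * w s).

Let integrable_shifted h t : 0 <= h -> 0 <= t ->
  mu.-integrable `[0, h] (EFin \o (fun s => k (t + h - s) * w s)).
Proof.
move=> h0 t0; apply: integrableS (integrable_volterra k_int (addr_ge0 t0 h0) cw) => //.
by apply: subset_itvl; rewrite bnd_simp lerDr.
Qed.

Let relaxation_shift h t : 0 <= h -> 0 <= t ->
  w (t + h) + m * (shifted_mass h t + \int[mu]_(s in `[0, t]) (k (t - s) * w (s + h))) = 1.
Proof.
move=> h0 t0; rewrite -(eqw (addr_ge0 t0 h0)); congr (_ + m * _).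
have i1 := integrable_volterra k_int (addr_ge0 t0 h0) cw.
have i2 : mu.-integrable `]h, t + h] (EFin \o (fun s => k (t + h - s) * w s)).
  by apply: integrableS i1 => //; apply: subset_itvr; rewrite bnd_simp.
have := Rintegral_itvB i1 (_ : BLeft 0 <= BRight h)%O (_ : BRight h <= BRight (t + h))%O.
rewrite !bnd_simp lerDr => /(_ h0 t0); rewrite -/(shifted_mass h t).
rewrite Rintegral_itv_obnd_cbnd//.
have := @ge0_Rintegral_shift _ 0 t h (fun s => k (t + h - s) * w s).
rewrite add0r => ->; last 2 first.
- apply: measurable_funM; last exact: continuous_measurable_fun.
  by apply: measurableT_comp => //; exact: measurable_reflect.
- by move=> y /andP[hy _]; rewrite mulr_ge0// ltW// relaxation_gt0// (le_trans h0).
have -> : \int[mu]_(s in `[0, t]) (k (t + h - (s + h)) * w (s + h)) =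
    \int[mu]_(s in `[0, t]) (k (t - s) * w (s + h)).
  by apply: eq_Rintegral => s _; congr (k _ * _); ring.
by move=> <-; ring.
Qed.

(* The increment w t - w (t + h) solves the Volterra equation whose right-hand side
   is a positive mixture of translates of k; log-convexity of k makes it admissible. *)
Lemma relaxation_decr t h : 0 <= t -> 0 < h -> w (t + h) < w t.
Proof.
move=> t0 h0; rewrite -subr_gt0; have h_ge0 := ltW h0.
have cwh : continuous (fun s => w (s + h)).
  move=> s; apply: (@continuous_comp _ _ _ (fun s => s + h) w); last exact: cw.
  by apply: cvgD; [exact: cvg_id|exact: cvg_cst].
have mass_gt0 u : 0 <= u -> 0 < m * shifted_mass h u.
  move=> u0; have [c /[!in_itv]/= /andP[c0 ch] wmin] :=
    EVT_min h_ge0 (continuous_subspaceT cw).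
  have wc := relaxation_gt0 c0.
  rewrite mulr_gt0//; apply: (@lt_le_trans _ _ (\int[mu]_(s in `[0, h]) w c)).
    by rewrite Rintegral_cst//= lebesgue_measure_itv/= lte_fin h0/= subr0 mulr_gt0.
  apply: le_Rintegral => //; last 2 first.
  - exact: integrable_shifted.
  - move=> s sh; apply: (le_trans (wmin _ sh)); rewrite ler_peMl//.
    exact: w_itv_ge0 sh.
  apply: continuous_compact_integrable; first exact: segment_compact.
  by apply: continuous_subspaceT => ?; exact: cvg_cst.
have eqW u : 0 <= u -> (w u - w (u + h)) +
    m * \int[mu]_(s in `[0, u]) (k (u - s) * (w s - w (s + h))) = m * shifted_mass h u.
  move=> u0.
  have -> : \int[mu]_(s in `[0, u]) (k (u - s) * (w s - w (s + h))) =
      \int[mu]_(s in `[0, u]) (k (u - s) * w s) -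
      \int[mu]_(s in `[0, u]) (k (u - s) * w (s + h)).
    rewrite -RintegralB//; [|exact: integrable_volterra..].
    by apply: eq_Rintegral => s _; ring.
  have := eqw u0; have := relaxation_shift h_ge0 u0; lra.
apply: (volterra_scale_gt0 m_gt0 _ _ eqW) => //.
- by move=> s; apply: cvgB; [exact: cw|exact: cwh].
- have := eqW 0 (lexx 0); rewrite set_itv1 Rintegral_set1 mulr0 addr0 => ->.
  exact: mass_gt0.
- move=> T _; exists 1 => u /andP[u0 _].
  have := relaxation_shift h_ge0 u0.
  have : 0 < w (u + h) by apply: relaxation_gt0; exact: addr_ge0.
  have : 0 <= m * \int[mu]_(s in `[0, u]) (k (u - s) * w (s + h)).
    apply: mulr_ge0; first exact: ltW.
    apply: Rintegral_ge0 => s; rewrite /= in_itv/= => /andP[s0 _].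
    by rewrite mulr_ge0// ltW// relaxation_gt0// addr_ge0.
  lra.
- move=> s u u' s0 su uu'; rewrite -!mulrA ler_pM2l// ![shifted_mass _ _ * _]mulrC.
  have u0 : 0 <= u by lra.
  rewrite /shifted_mass -!RintegralZl//; [|apply: integrable_shifted => //; lra..].
  apply: le_Rintegral => //; [apply: integrable_scale => //; apply: integrable_shifted => //; lra..|].
  move=> r rh; rewrite !mulrA ler_wpM2r//; first exact: w_itv_ge0 rh.
  move: rh; rewrite /= in_itv/= => /andP[r0 rh].
  (* The base points satisfy [u - s <= u + h - r] because [0 <= s] and [r <= h]. Integrating over
     [r] against [w] gives the comparison hypothesis for the mass. *)
  have := @k_logconvex (u - s) (u + h - r) (u' - u).
  have -> : u - s + (u' - u) = u' - s by ring.
  have -> : u + h - r + (u' - u) = u' + h - r by ring.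
  by rewrite ![k (_ - s) * _]mulrC; apply; lra.
Qed.

Lemma relaxation_nonincreasing s t : 0 <= s -> s <= t -> w t <= w s.
Proof.
move=> s0; rewrite le_eqVlt => /predU1P[->//|st].
have := relaxation_decr s0 (_ : 0 < t - s).
by rewrite subr_gt0 addrC subrK => /(_ st)/ltW.
Qed.

Lemma relaxation_itv_ge a b : 0 <= a -> a <= b ->
  (b - a) * w b <= \int[mu]_(s in `[a, b]) w s.
Proof.
move=> a0 ab; apply: (@le_trans _ _ (\int[mu]_(s in `[a, b]) w b)).
  rewrite Rintegral_cst//= lebesgue_measure_itv/= lte_fin.
  move: ab; rewrite le_eqVlt => /predU1P[->|->]/=; first by rewrite subrr ltxx mulr0 mul0r.
  by rewrite mulrC.
apply: le_Rintegral => //.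
- apply: continuous_compact_integrable; first exact: segment_compact.
  by apply: continuous_subspaceT => ?; exact: cvg_cst.
- by apply: integrableS (iw b) => //; apply: subset_itvr; rewrite bnd_simp.
- move=> s; rewrite /= in_itv/= => /andP[sa sb]; apply: relaxation_nonincreasing => //.
  exact: le_trans sa.
Qed.

(** For a nonincreasing [w] the rectangle of base [t] and height [w t] lies under the graph, so the
    integral bound yields a rate. *)
Lemma relaxation_decay t : 0 <= t -> m * (t * w t) <= 1.
Proof.
move=> t0; apply: le_trans (relaxation_integral t0); rewrite ler_pM2l//.
by have := relaxation_itv_ge (lexx 0) t0; rewrite subr0.
Qed.

(** The function [s |-> w (t - s)] is nondecreasing, so sums tagged at left endpoints are lower
    sums; the bound holds for every partition, before any limit is taken. *)
Lemma relaxation_left_sum t n (x : nat -> R) : x 0%N = 0 -> x n = t ->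
  (forall i, (i < n)%N -> x i <= x i.+1) ->
  m * \sum_(i < n) (x i.+1 - x i) * w (t - x i) <= 1.
Proof.
move=> x0 xn xle.
have xmono i j : (i <= j)%N -> (j <= n)%N -> x i <= x j.
  elim: j => [|j IH]; first by rewrite leqn0 => /eqP->.
  rewrite leq_eqVlt => /predU1P[->//|]; rewrite ltnS => ij jn.
  by apply: le_trans (xle _ jn); apply: IH => //; exact: ltnW.
have t0 : 0 <= t by rewrite -xn -x0 xmono.
apply: le_trans (relaxation_integral t0); rewrite ler_pM2l//.
suff H j : (j <= n)%N -> \sum_(i < j) (x i.+1 - x i) * w (t - x i) <=
    \int[mu]_(s in `[t - x j, t]) w s.
  by have := H n (leqnn n); rewrite xn subrr.
elim: j => [|j IH] jn.
  by rewrite big_ord0 x0 subr0 set_itv1 Rintegral_set1.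
rewrite big_ord_recr/=.
have x0j : 0 <= x j by rewrite -x0 xmono// ltnW.
have xjt : x j.+1 <= t by rewrite -xn xmono.
have xj := xle _ jn.
have i1 : mu.-integrable `[t - x j.+1, t] (EFin \o w).
  by apply: integrableS (iw t) => //; apply: subset_itvr; rewrite bnd_simp subr_ge0.
have := Rintegral_itvB i1 (_ : BLeft (t - x j.+1) <= BRight (t - x j))%O
  (_ : BRight (t - x j) <= BRight t)%O.
rewrite !bnd_simp => /(_ ltac:(lra) ltac:(lra)).
rewrite Rintegral_itv_obnd_cbnd; last first.
  by apply: integrableS i1 => //; apply: subset_itvr; rewrite bnd_simp; lra.
have := IH (ltnW jn).
have := @relaxation_itv_ge (t - x j.+1) (t - x j).
have -> : t - x j - (t - x j.+1) = x j.+1 - x j by ring.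
by move=> /(_ ltac:(lra) ltac:(lra)); lra.
Qed.

End one_parameter.

(** The difference [w1 - w2] vanishes at 0, where the first-zero argument needs a positive value;
    hence the factor [1 - d] on [w2]. Using the second equation to express [k * w2] as
    [(1 - w2) / m2], the combination solves the equation of parameter [m1] with right-hand side
    [d + c * (1 - w2)], which is positive and nondecreasing because [w2] is nonincreasing. *)
Lemma relaxation_param_le (m1 m2 : R) (w1 w2 : R -> R) : 0 < m1 -> m1 <= m2 ->
  volterra_relaxation m1 w1 -> volterra_relaxation m2 w2 ->
  forall t : R, 0 <= t -> w2 t <= w1 t.
Proof.
move=> m1_gt0 m12 w1_rel w2_rel t t0; rewrite leNgt; apply/negP => w12.
have m2_gt0 : 0 < m2 by exact: lt_le_trans m12.
have w1t := relaxation_gt0 m1_gt0 w1_rel t0.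
have w2t := relaxation_le1 m2_gt0 w2_rel t0.
pose d := (w2 t - w1 t) / 2.
have d_gt0 : 0 < d by rewrite /d; lra.
have d_lt1 : d < 1 by rewrite /d; lra.
suff : 0 < w1 t - (1 - d) * w2 t.
  have : d * w2 t <= d by rewrite ger_pMr.
  have -> : (1 - d) * w2 t = w2 t - d * w2 t by ring.
  by rewrite /d; lra.
pose c := (1 - d) * (m2 - m1) / m2.
have c_ge0 : 0 <= c.
  by rewrite /c divr_ge0 ?(ltW m2_gt0)// mulr_ge0//; lra.
apply: (@volterra_scale_gt0 m1 (fun t => w1 t - (1 - d) * w2 t)
   (fun t => d + c * (1 - w2 t))) => //.
- move=> s; apply: cvgB; first exact: w1_rel.1.
  by apply: cvgM; [exact: cvg_cst|exact: w2_rel.1].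
- rewrite (relaxation0 w1_rel) (relaxation0 w2_rel); lra.
- move=> s s0.
  have i1 := integrable_volterra k_int s0 w1_rel.1.
  have i2 := integrable_volterra k_int s0 w2_rel.1.
  have -> : \int[mu]_(r in `[0, s]) (k (s - r) * (w1 r - (1 - d) * w2 r)) =
      \int[mu]_(r in `[0, s]) (k (s - r) * w1 r) -
      (1 - d) * \int[mu]_(r in `[0, s]) (k (s - r) * w2 r).
    rewrite -RintegralZl// -RintegralB//; last exact: integrable_scale.
    by apply: eq_Rintegral => r _; ring.
  have := w1_rel.2 _ s0; have := w2_rel.2 _ s0.
  set I1 := \int[mu]_(r in _) (_ * w1 _); set I2 := \int[mu]_(r in _) (_ * w2 _).
  move=> e2 e1; have -> : w1 s = 1 - m1 * I1 by lra.
  have -> : w2 s = 1 - m2 * I2 by lra.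
  by rewrite /c; field; rewrite gt_eqF.
- move=> s s0; have := relaxation_le1 m2_gt0 w2_rel s0 => ws.
  by rewrite ltr_pwDl// mulr_ge0// subr_ge0.
- move=> T _; exists (d + c) => s /andP[s0 _].
  have := relaxation_gt0 m2_gt0 w2_rel s0 => ws.
  by rewrite lerD2l ler_piMr//; lra.
- move=> r s s' r0 rs ss'.
  have s0 : 0 <= s by lra.
  have ws := relaxation_le1 m2_gt0 w2_rel s0.
  have ws' := relaxation_nonincreasing m2_gt0 w2_rel s0 ss'.
  have h1 : 0 <= c * (1 - w2 s) by rewrite mulr_ge0// subr_ge0.
  have h2 : c * (1 - w2 s) <= c * (1 - w2 s') by rewrite ler_wpM2l// lerD2l lerN2.
  apply: ler_pM => //; [lra|lra|apply: k_le; lra].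
Qed.

End relaxation_kernel.

(** * The Rayleigh-Stokes kernel *)

Section power_kernel.
Context {R : realType}.
Local Notation mu := (@lebesgue_measure R).

(** The bound is free of [e], so it survives the passage to the singular endpoint. *)
Lemma integral_powR_le (b e t : R) : 0 < b -> 0 < e -> e <= t ->
  (\int[mu]_(x in `[e, t]) (x `^ (b - 1))%:E <= (t `^ b / b)%:E)%E.
Proof.
move=> b0 e0; rewrite le_eqVlt => /predU1P[<-|et].
  by rewrite set_itv1 integral_set1 lee_fin divr_ge0 ?powR_ge0// ltW.
pose F x := b^-1 * x `^ b.
have dF (x : R) : 0 < x -> is_derive x 1 F (x `^ (b - 1)).
  move=> x0; have D := is_derive1_powR b x0.
  have D' := is_deriveZ b^-1 D.
  have -> : x `^ (b - 1) = b^-1 *: (b * x `^ (b - 1) : R^o).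
    by rewrite /GRing.scale/=; field; rewrite gt_eqF.
  exact: D'.
have cF (x : R) : 0 < x -> {for x, continuous F}.
  by move=> x0; apply: differentiable_continuous; apply/derivable1_diffP; have [] := dF x x0.
rewrite (@continuous_FTC2 _ _ F)//.
- rewrite -EFinB lee_fin /F mulrC lerBlDr lerDl mulr_ge0 ?powR_ge0// invr_ge0 ltW//.
- apply/(continuous_within_itvP _ et).
  have cf (x : R) : 0 < x -> {for x, continuous (fun x : R => x `^ (b - 1))}.
    move=> x0; apply: differentiable_continuous; apply/derivable1_diffP.
    by have [] := is_derive1_powR (b - 1) x0.
  split; first by move=> x; rewrite in_itv/= => /andP[ex _]; apply: cf; exact: lt_trans ex.
    by apply: cvg_at_right_filter; exact: cf.
  by apply: cvg_at_left_filter; apply: cf; exact: lt_trans et.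
- split.
  + by move=> x; rewrite in_itv/= => /andP[ex _]; have [] := dF x (lt_trans e0 ex).
  + by apply: cvg_at_right_filter; exact: cF.
  + by apply: cvg_at_left_filter; apply: cF; exact: lt_trans et.
- move=> x; rewrite in_itv/= => /andP[ex _]; rewrite derive1E.
  by have D := dF x (lt_trans e0 ex); rewrite derive_val.
Qed.

(** Monotone convergence along the intervals from [1 / (n + 1)] to [t], which exhaust []0, t]]; the
    endpoint 0 is a null set. *)
Lemma integrable_powR (b t : R) : 0 < b -> 0 <= t ->
  mu.-integrable `[0, t] (EFin \o (fun x => x `^ (b - 1))).
Proof.
move=> b0 t0; apply/integrableP; split.
  by apply/measurable_EFinP; apply: measurable_funTS; exact: measurable_powR.
rewrite [X in (X < _)%E](_ : _ = \int[mu]_(x in `]0%R, t]) ((x : R) `^ (b - 1))%R%:E)%E; last first.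
  rewrite integral_itv_obnd_cbnd; last first.
    by apply/measurable_EFinP; apply: measurable_funTS; exact: measurable_powR.
  by apply: eq_integral => x _ /=; rewrite ger0_norm// powR_ge0.
have -> : `]0, t]%classic = \bigcup_n `[n.+1%:R^-1, t]%classic :> set R.
  apply/seteqP; split => [x /=|x [n _] /=]; rewrite !in_itv/=.
    move=> /andP[x0 xt].
    have [n _ /(_ n (leqnn n)) nx] := near_infty_natSinv_lt (PosNum x0).
    by exists n => //=; rewrite in_itv/= xt ltW.
  by move=> /andP[nx ->]; rewrite (lt_le_trans _ nx).
have := @ge0_nondecreasing_set_cvg_integral _ _ R
  (fun n => `[n.+1%:R^-1, t]%classic : set (measurableTypeR R)) (fun x => (x `^ (b - 1))%:E) mu.
move=> /(_ _ _ _ _)/cvg_lim <-//; last 3 first.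
- move=> m n mn; apply/subsetPset; apply: subset_itvr.
  by rewrite bnd_simp lef_pV2 ?posrE// ler_nat.
- by move=> i; apply/measurable_EFinP; apply: measurable_funTS; exact: measurable_powR.
- by move=> i x _; rewrite lee_fin powR_ge0.
apply: (@le_lt_trans _ _ (t `^ b / b)%:E); last exact: ltry.
apply: lime_le.
  apply: ereal_nondecreasing_is_cvgn => m n mn; apply: ge0_subset_integral => //.
  - by apply/measurable_EFinP; apply: measurable_funTS; exact: measurable_powR.
  - by move=> x _; rewrite lee_fin powR_ge0.
  - by apply: subset_itvr; rewrite bnd_simp lef_pV2 ?posrE// ler_nat.
apply: nearW => n; have [nt|tn] := leP n.+1%:R^-1 t.
  exact: integral_powR_le.
rewrite set_itv_ge ?integral_set0 ?bnd_simp -?ltNge//.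
by rewrite lee_fin divr_ge0 ?powR_ge0// ltW.
Qed.

Context (c b : R).
Hypothesis c_ge0 : 0 <= c.
Hypothesis b_itv : 0 < b < 1.

(** With [b = 1 - alpha] and [c = gamma / Gamma (1 - alpha)] this is the memory kernel
    [1 + gamma * gker (1 - alpha)] of the relaxation equation. *)
Definition power_kernel (x : R) : R := 1 + c * x `^ (b - 1).

Let b0 : 0 < b. Proof. by case/andP: b_itv. Qed.

Lemma measurable_power_kernel : measurable_fun setT power_kernel.
Proof.
by apply: measurable_funD => //; apply: measurable_funM => //; exact: measurable_powR.
Qed.

Lemma power_kernel_ge1 x : 1 <= power_kernel x.
Proof. by rewrite lerDl mulr_ge0// powR_ge0. Qed.

Let powR_le (x y : R) : 0 < x -> x <= y -> y `^ (b - 1) <= x `^ (b - 1).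
Proof.
move=> x0 xy; have -> : b - 1 = - (1 - b) by ring.
have y0 := lt_le_trans x0 xy.
rewrite !powRN lef_pV2 ?posrE ?powR_gt0//.
have b1 : 0 <= 1 - b by have /andP[_ ?] := b_itv; lra.
by apply: ge0_ler_powR => //; rewrite nnegrE ltW.
Qed.

Lemma power_kernel_le (x y : R) : 0 < x -> x <= y -> power_kernel y <= power_kernel x.
Proof. by move=> x0 xy; rewrite lerD2l ler_wpM2l// powR_le. Qed.

(** For the pure power this is antitonicity of the exponent map, because
    [y * (x + h) - (y + h) * x = h * (y - x)] is nonnegative. The added constant 1 creates cross
    terms, which require the analogous inequality for sums. *)
Lemma power_kernel_logconvex (x y h : R) : 0 < x -> x <= y -> 0 <= h ->
  power_kernel y * power_kernel (x + h) <= power_kernel (y + h) * power_kernel x.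
Proof.
move=> x0 xy h0; rewrite /power_kernel.
have y0 : 0 < y := lt_le_trans x0 xy.
have xh0 : 0 < x + h by rewrite ltr_wpDr.
have yh0 : 0 < y + h by rewrite ltr_wpDr.
have prod_le : y `^ (b - 1) * (x + h) `^ (b - 1) <= (y + h) `^ (b - 1) * x `^ (b - 1).
  rewrite -(powRM _ (ltW y0) (ltW xh0)) -(powRM _ (ltW yh0) (ltW x0)).
  apply: powR_le; first by rewrite mulr_gt0.
  by nra.
have XY := powR_le x0 xy; have XXh := powR_le x0 (_ : x <= x + h).
have YYh := powR_le y0 (_ : y <= y + h).
have X0 := powR_gt0 (b - 1) x0; have Y0 := powR_gt0 (b - 1) y0.
have Xh0 := powR_gt0 (b - 1) xh0; have Yh0 := powR_gt0 (b - 1) yh0.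
move: XXh YYh; rewrite !lerDl => /(_ h0) XXh /(_ h0) YYh.
move: prod_le XY XXh YYh X0 Y0 Xh0 Yh0.
move: (x `^ _) (y `^ _) ((x + h) `^ _) ((y + h) `^ _) => X Y X' Y' pr XY XX YY X0 Y0 X0' Y0'.
(* The product inequality reads [X * (Y - Y') <= Y * (X - X')]; replace the factor [Y] by the larger
   [X] and cancel it. *)
have sum_le : Y + X' <= Y' + X.
  have : X * (Y - Y') <= X * (X - X').
    have h1 : X * (Y - Y') <= Y * (X - X') by lra.
    have h2 : Y * (X - X') <= X * (X - X') by rewrite ler_wpM2r// subr_ge0.
    by lra.
  by rewrite ler_pM2l//; lra.
have h3 : c * (Y + X') <= c * (Y' + X) by rewrite ler_wpM2l.
have h4 : c * c * (Y * X') <= c * c * (Y' * X) by rewrite ler_wpM2l// mulr_ge0.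
by lra.
Qed.

Lemma integrable_power_kernel (t : R) : 0 <= t ->
  mu.-integrable `[0, t] (EFin \o (fun s => power_kernel (t - s))).
Proof.
move=> t0.
have i1 : mu.-integrable `[0, t] (EFin \o (fun s => (t - s) `^ (b - 1))).
  have /integrableP[_ fin] := integrable_powR b0 t0.
  apply/integrableP; split.
    apply/measurable_EFinP; apply: measurable_funTS.
    apply: (@measurableT_comp _ _ _ _ _ _ (fun x : R => x `^ (b - 1))).
      exact: measurable_powR.
    exact: measurable_reflect.
  move: fin; rewrite (@ge0_integral_reflect _ t)//; last first.
    apply/measurable_EFinP; apply: measurableT_comp => //.
    by apply: measurable_funTS; exact: measurable_powR.
  by rewrite preimage_reflect/= subr0 subrr.
rewrite (_ : _ \o _ = (EFin \o (fun=> 1%R)) \+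
  (EFin \o (fun s : R => (c * (t - s) `^ (b - 1))%R)))%E.
  apply: integrableD => //; last exact: integrable_scale.
  apply: continuous_compact_integrable; first exact: segment_compact.
  by apply: continuous_subspaceT => ?; exact: cvg_cst.
by apply/funext => s /=; rewrite -EFinD.
Qed.

End power_kernel.

(** * The Hilbert space L2 *)

Section L2_inner_product.
Context d (T : measurableType d) (R : realType).
Variable mu : {measure set T -> \bar R}.
Local Notation H := (L2space mu).
Implicit Types u v w : H.

Lemma L2norm_sqr u : ((`|u| ^+ 2)%:E = \int[mu]_x (L2fun u x ^+ 2)%:E)%E.
Proof.
have -> : `|u| = fine ('N[mu]_2%:E [EFin \o (L2rep u : T -> R)])%E by [].
rewrite -powR_mulrn ?fine_ge0 ?Lnorm_ge0// -poweR_EFin finite_norm_fine.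
rewrite poweR_Lnorm//; apply: eq_integral => x _ /=.
by rewrite powR_mulrn// real_normK// num_real.
Qed.

Lemma L2funB u v : L2fun (u - v) = (fun x => L2fun u x - L2fun v x) %[ae mu].
Proof.
have h1 := L2repE (L2rep u + L2rep (- v)).
have h2 := L2repE (- L2rep v).
apply: filterS2 h1 h2 => x /(_ I) e1 /(_ I) e2 _.
have {}e2 : L2fun (- v) x = - L2fun v x by exact: e2.
by rewrite -e2; exact: e1.
Qed.

Lemma L2funD u v : L2fun (u + v) = (fun x => L2fun u x + L2fun v x) %[ae mu].
Proof. by apply: filterS (L2repE (L2rep u + L2rep v)) => x /(_ I) e _. Qed.

Lemma L2funZ (a : R) u : L2fun (a *: u) = (fun x => a * L2fun u x) %[ae mu].
Proof. by apply: filterS (L2repE (a *: L2rep u)) => x /(_ I) e _. Qed.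

Lemma integrable_L2inner u v :
  mu.-integrable setT (EFin \o (fun x => L2fun u x * L2fun v x)).
Proof. by apply/Lfun1_integrable; apply: Lfun2_mul_Lfun1; exact: L2fun_in. Qed.

Let measurable_prod u v : measurable_fun setT (fun x => L2fun u x * L2fun v x).
Proof. by apply: measurable_funM; exact: measurable_L2fun. Qed.

Lemma L2innerDl u v w : L2inner (u + v) w = L2inner u w + L2inner v w.
Proof.
rewrite /L2inner -RintegralD//; [|exact: integrable_L2inner..].
congr fine; apply: ae_eq_integral => //.
- exact/measurable_EFinP.
- by apply/measurable_EFinP; apply: measurable_funD.
- by apply: filterS (L2funD u v) => x /(_ I) -> _; rewrite mulrDl.
Qed.

Lemma L2innerZl a u v : L2inner (a *: u) v = a * L2inner u v.
Proof.
rewrite /L2inner -RintegralZl//; last exact: integrable_L2inner.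
congr fine; apply: ae_eq_integral => //.
- exact/measurable_EFinP.
- by apply/measurable_EFinP; apply: measurable_funM.
- by apply: filterS (L2funZ a u) => x /(_ I) -> _; rewrite mulrA.
Qed.

Lemma L2innerC u v : L2inner u v = L2inner v u.
Proof. by apply: eq_Rintegral => x _; rewrite mulrC. Qed.

Lemma L2innerE u : L2inner u u = `|u| ^+ 2.
Proof.
apply: EFin_inj; rewrite L2norm_sqr -[LHS]fineK//= fineK//.
exact: (integrable_fin_num measurableT (integrable_L2inner u u)).
Qed.

Lemma L2space_of_fun (f : T -> R) : measurable_fun setT f ->
  (\int[mu]_x (f x ^+ 2)%:E < +oo)%E -> exists u : H, L2fun u = f %[ae mu].
Proof.
move=> mf f2.
have fin : f \in Lfun mu 2%:E.
  rewrite inE; apply/andP; split; rewrite inE//= /finite_norm unlock.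
  rewrite poweR_lty//; apply: le_lt_trans f2; rewrite le_eqVlt; apply/orP; left.
  apply/eqP; apply: eq_integral => x _ /=.
  by rewrite powR_mulrn// real_normK// num_real.
by exists (L2class (Lfun_Sub (lee1n 2) fin)); exact: L2repE.
Qed.

End L2_inner_product.

(** * Completeness of L2 *)

Section L2_complete.
Context d (T : measurableType d) (R : realType).
Variable mu : {measure set T -> \bar R}.
Local Notation H := (L2space mu).

Let q : R := 4^-1.

Section fast_sequence.
Variable v : nat -> H.
Hypothesis v_fast : forall k, `|v k.+1 - v k| <= q ^+ k.

(** The weight balances two needs: the integrals stay below [4 ^ k / 16 ^ k], hence are summable,
    while finiteness of the sum at a point forces increments of order [2 ^ -k] there. This takes the
    place of Minkowski's inequality for infinite sums. *)
Let D k x : \bar R := (4 ^+ k * L2fun (v k.+1 - v k) x ^+ 2)%:E.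

Let D_ge0 k x : (0 <= D k x)%E.
Proof. by rewrite lee_fin; apply: mulr_ge0; [exact: exprn_ge0|exact: sqr_ge0]. Qed.

Let mD k : measurable_fun setT (D k).
Proof.
apply/measurable_EFinP; apply: measurable_funM => //.
by apply: measurable_funX; exact: measurable_L2fun.
Qed.

Let int_D k : (\int[mu]_x D k x <= (q ^+ k)%:E)%E.
Proof.
rewrite /D; under eq_integral do rewrite EFinM.
rewrite ge0_integralZl//; last 2 first.
- by apply/measurable_EFinP; apply: measurable_funX; exact: measurable_L2fun.
- by move=> x _; rewrite lee_fin sqr_ge0.
rewrite -L2norm_sqr -EFinM lee_fin.
have -> : q ^+ k = 4 ^+ k * (q ^+ k) ^+ 2.
  by rewrite expr2 mulrA -exprMn mulfV// expr1n mul1r.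
by rewrite ler_wpM2l ?exprn_ge0// lerXn2r ?nnegrE// exprn_ge0// invr_ge0.
Qed.

Lemma fast_cauchy_ae_cvg :
  {ae mu, forall x, cvgn (fun k => L2fun (v k) x)}.
Proof.
have sum_fin : (\int[mu]_x \sum_(k <oo) D k x < +oo)%E.
  rewrite integral_nneseries//.
  apply: (@le_lt_trans _ _ 2%:E); last exact: ltry.
  apply: (@le_trans _ _ (\sum_(k <oo) (q ^+ k)%:E)%E).
    by apply: lee_nneseries => [k _ _|k _]; [exact: integral_ge0|exact: int_D].
  apply: lime_le; first by apply: is_cvg_nneseries => k _ _; rewrite lee_fin exprn_ge0// invr_ge0.
  apply: nearW => n; rewrite big_mkord sumEFin lee_fin.
  suff -> : \sum_(i < n) q ^+ i = 4 / 3 - 4 / 3 * q ^+ n.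
    have : 0 <= q ^+ n by rewrite exprn_ge0// invr_ge0.
    lra.
  elim: n => [|n IH]; first by rewrite big_ord0 expr0; lra.
  by rewrite big_ord_recr/= IH exprS /q; lra.
have ifin : mu.-integrable setT (fun x => \sum_(k <oo) D k x)%E.
  apply/integrableP; split.
    by apply: ge0_emeasurable_sum => // k x _ _; exact: D_ge0.
  apply: le_lt_trans sum_fin; rewrite le_eqVlt; apply/orP; left; apply/eqP.
  by apply: eq_integral => x _; rewrite gee0_abs// nneseries_ge0.
have hB : {ae mu, forall x k, L2fun (v k.+1 - v k) x = L2fun (v k.+1) x - L2fun (v k) x}.
  by apply/ae_foralln => k; apply: filterS (L2funB (v k.+1) (v k)) => x; apply.
apply: filterS2 (integrable_ae measurableT ifin) hB => x /(_ I) fx dx.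
pose M := fine (\sum_(k <oo) D k x)%E.
have DM k : 4 ^+ k * (L2fun (v k.+1) x - L2fun (v k) x) ^+ 2 <= M.
  rewrite -dx -lee_fin /M fineK//; apply: le_trans (nneseries_lim_ge k.+1 _) => //.
  by rewrite big_mkord big_ord_recr/= leeDr// sume_ge0.
have M0 : 0 <= M by apply: le_trans (DM 0%N); rewrite mulr_ge0// sqr_ge0.
(* [M + 1] serves as an upper bound for the square root of [M], since [M <= (M + 1) ^ 2]. *)
have bound k : `|L2fun (v k.+1) x - L2fun (v k) x| <= (M + 1) * 2^-1 ^+ k.
  rewrite -(@ler_pXn2r _ 2)// ?nnegrE ?mulr_ge0 ?exprn_ge0 ?invr_ge0//; last by lra.
  rewrite real_normK ?num_real// exprMn -exprM mulnC exprM.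
  have -> : 2^-1 ^+ 2 = q by rewrite exprVn -natrX.
  rewrite /q exprVn -[leRHS]mulrC ler_pdivlMl ?exprn_gt0//.
  by apply: (le_trans (DM k)); nra.
have cvgd : cvgn (series (fun k => L2fun (v k.+1) x - L2fun (v k) x)).
  apply: normed_cvg; apply: (@series_le_cvg _ _ (fun k => (M + 1) * 2^-1 ^+ k)).
  - by move=> k /=.
  - by move=> k; rewrite mulr_ge0 ?exprn_ge0 ?invr_ge0//; lra.
  - by move=> k; exact: bound.
  - have := @is_cvg_geometric_series R (M + 1) 2^-1; apply.
    by rewrite ger0_norm ?invr_ge0// invf_lt1// ltr1n.
have -> : (fun k => L2fun (v k) x) =
    (fun k => L2fun (v 0%N) x + series (fun k => L2fun (v k.+1) x - L2fun (v k) x) k).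
  apply/funext => k; rewrite /series/= telescope_sumr// addrC subrK//.
by apply: is_cvgD => //; exact: is_cvg_cst.
Qed.

End fast_sequence.

(** The Riesz-Fischer theorem: a fast subsequence converges almost everywhere, and Fatou's lemma
    turns its pointwise limit into a limit in norm of the whole sequence. *)
Lemma L2space_cauchy_cvg (u : nat -> H) :
  (forall e : R, 0 < e -> exists N, forall m n, (N <= m)%N -> (N <= n)%N -> `|u m - u n| <= e) ->
  exists l : H, u @ \oo --> l.
Proof.
move=> cu.
have q0 k : 0 < q ^+ k by rewrite exprn_gt0// invr_gt0.
pose N k := projT1 (cid (cu _ (q0 k))).
have NP k m n : (N k <= m)%N -> (N k <= n)%N -> `|u m - u n| <= q ^+ k.
  by rewrite /N; case: cid => /= N0; apply.
(* The running maximum puts both [nk k] and [nk k.+1] beyond [N k]. *)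
pose nk k := \max_(i < k.+1) N i.
have Nnk i k : (i <= k)%N -> (N i <= nk k)%N.
  by move=> ik; exact: (@leq_bigmax _ (fun i : 'I_k.+1 => N i) (Ordinal (ik : (i < k.+1)%N))).
pose v k := u (nk k).
have vfast k : `|v k.+1 - v k| <= q ^+ k by apply: NP; exact: Nnk.
(* An upper limit is defined and measurable everywhere, including on the null set where the
   subsequence diverges. *)
pose F x : \bar R := limn_esup (fun k => (L2fun (v k) x)%:E).
have mF : measurable_fun setT F.
  apply: measurable_fun_limn_esup => k.
  by apply/measurable_EFinP; exact: measurable_L2fun.
pose f x := fine (F x).
have mf : measurable_fun setT f by apply: measurableT_comp mF.
have fv : {ae mu, forall x, (fun k => L2fun (v k) x) @ \oo --> f x}.
  apply: filterS (fast_cauchy_ae_cvg vfast) => x cx.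
  rewrite /f /F is_cvg_limn_esupE; last first.
    apply/cvg_ex; exists (limn (fun k => L2fun (v k) x))%:E.
    by apply/fine_cvgP; split => //; exact: nearW.
  rewrite (_ : limn _ = (limn (fun k => L2fun (v k) x))%:E)//.
  by apply/cvg_lim => //; apply/fine_cvgP; split => //; exact: nearW.
have dist k n : (N k <= n)%N ->
    (\int[mu]_x ((f x - L2fun (u n) x) ^+ 2)%:E <= ((q ^+ k) ^+ 2)%:E)%E.
  move=> kn.
  have mdiff j : measurable_fun setT (fun x => (L2fun (v j - u n) x ^+ 2)%:E).
    by apply/measurable_EFinP; apply: measurable_funX; exact: measurable_L2fun.
  have E : {ae mu, forall x, setT x -> ((f x - L2fun (u n) x) ^+ 2)%:E =
      limn_einf (fun j => (L2fun (v j - u n) x ^+ 2)%:E)}.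
    have hB : {ae mu, forall x j, L2fun (v j - u n) x = L2fun (v j) x - L2fun (u n) x}.
      by apply/ae_foralln => j; apply: filterS (L2funB (v j) (u n)) => x; apply.
    apply: filterS2 fv hB => x cx dx _.
    have cx2 : (fun j => (L2fun (v j - u n) x ^+ 2)%:E) @ \oo --> ((f x - L2fun (u n) x) ^+ 2)%:E.
      apply/fine_cvgP; split; first exact: nearW.
      under eq_cvg => j do rewrite /= dx.
      by rewrite expr2; apply: cvgM; apply: cvgB => //; exact: cvg_cst.
    by rewrite is_cvg_limn_einfE; [apply/esym/cvg_lim|apply/cvg_ex; eexists; exact: cx2].
  rewrite (ge0_ae_eq_integral _ _ _ _ _ E)//; last 4 first.
  - apply/measurable_EFinP; apply: measurable_funX; apply: measurable_funB => //.
    exact: measurable_L2fun.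
  - rewrite (_ : (fun x => _) = (fun x => - limn_esup (fun j => - (L2fun (v j - u n) x ^+ 2)%:E))%E).
      apply: measurableT_comp => //; apply: measurable_fun_limn_esup => j.
      exact: measurableT_comp.
    by apply/funext => x; rewrite -[LHS]oppeK -limn_esupN.
  - by move=> x _; rewrite lee_fin sqr_ge0.
  - move=> x _; rewrite limn_einf_lim; apply: lime_ge; first exact: is_cvg_einfs.
    by apply: nearW => j; apply: le_ereal_inf_tmp => _ [i _ <-]; rewrite lee_fin sqr_ge0.
  apply: le_trans (fatou mu measurableT _ _) _ => //.
    by move=> j x _; rewrite lee_fin sqr_ge0.
  under eq_fun do rewrite -L2norm_sqr.
  apply: (le_trans (limn_einf_sup _)).
  rewrite limn_esup_lim; apply: lime_le; first exact: is_cvg_esups.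
  exists k => // j /= kj; apply: ge_ereal_sup => _ [i /= ji <-]; rewrite lee_fin.
  rewrite lerXn2r ?nnegrE ?(ltW (q0 _))//; apply: NP => //.
  by apply: Nnk; exact: leq_trans ji.
(* Square integrability is known for differences of [f] with far terms of [u], so the limit is built
   from such a difference. *)
have [w fw] : exists w : H, L2fun w = (fun x => f x - L2fun (u (N 0%N)) x) %[ae mu].
  apply: L2space_of_fun; first by apply: measurable_funB => //; exact: measurable_L2fun.
  by apply: le_lt_trans (dist 0%N _ (leqnn _)) _; exact: ltry.
exists (w + u (N 0%N)).
apply/cvgrPdist_le => e e0.
have qcvg : (fun k => q ^+ k) @ \oo --> 0.
  by apply: cvg_expr; rewrite ger0_norm ?invr_ge0// invf_lt1// ltr1n.
have [k _ /(_ k (leqnn k)) qk] : \forall k \near \oo, q ^+ k <= e.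
  move/cvgrPdist_le : qcvg => /(_ _ e0); apply: filterS => k.
  by rewrite sub0r normrN ger0_norm// ltW.
exists (N k) => // n /= kn; apply: le_trans qk.
rewrite -(@ler_pXn2r _ 2)// ?nnegrE ?(ltW (q0 _))// -lee_fin L2norm_sqr.
apply: le_trans (dist _ _ kn); rewrite le_eqVlt; apply/orP; left; apply/eqP.
apply: ge0_ae_eq_integral => //.
- by apply/measurable_EFinP; apply: measurable_funX; exact: measurable_L2fun.
- apply/measurable_EFinP; apply: measurable_funX; apply: measurable_funB => //.
  exact: measurable_L2fun.
- by move=> x _; rewrite lee_fin sqr_ge0.
- by move=> x _; rewrite lee_fin sqr_ge0.
have h1 := L2funB (w + u (N 0%N)) (u n).
have h2 := L2funD w (u (N 0%N)).
apply: filterS3 fw h1 h2 => x /(_ I) e1 /(_ I) e2 /(_ I) e3 _.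
by rewrite e2 e3 e1 subrK.
Qed.

End L2_complete.

(** * Riemann integrals in Hilbert spaces *)

Section uniform_continuity.
Context {R : realType} {V : normedModType R}.

(* Uniformity in the parameter t is what makes convolution integrals uniform limits
   of their Riemann sums. *)
Lemma unif_continuous_param (G : R -> R -> V) (T e : R) : 0 < e ->
  continuous (fun x : R * R => G x.1 x.2) ->
  exists2 delta : R, 0 < delta & forall t s s', 0 <= t <= T -> 0 <= s <= T ->
    `|s - s'| < delta -> `|G t s - G t s'| <= e.
Proof.
move=> e0 cG.
have cK : compact (`[0, T] `*` `[0, T] : set (R * R)).
  by apply: compact_setX; exact: segment_compact.
have e20 : 0 < e / 2 by rewrite divr_gt0.
have cov (x : R * R) : `[0, T]%classic x.1 /\ `[0, T]%classic x.2 ->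
    \forall x' \near x & d \near (0:R)^'+,
    forall s', `|x'.2 - s'| < d -> `|G x'.1 x'.2 - G x'.1 s'| <= e.
  move=> _; have /cvgrPdist_lt /(_ _ e20)/nbhs_ballP[r /= r0 rG] := cG x.
  have r20 : 0 < r / 2 by rewrite divr_gt0.
  exists (ball x (r / 2), [set d | d < r / 2]) => /=.
    by split; [exact: nbhsx_ballx|exact: nbhs_right_lt].
  move=> [[t s] d] /= [[/= xt xs] dr] s' ss'.
  rewrite (splitr e) (le_trans (ler_distD (G x.1 x.2) _ _))// lerD//.
    rewrite distrC ltW//; apply: (rG (t, s)); split => /=.
      by apply: le_ball xt; lra.
    by apply: le_ball xs; lra.
  rewrite ltW//; apply: (rG (t, s')); split => /=; first by apply: le_ball xt; lra.
  rewrite [r]splitr; apply: ball_triangle xs _; rewrite /ball/=.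
  exact: lt_trans dr.
have := (compact_near_coveringP _).1 cK _ _ _ _ cov.
move=> /(_ _) near_d.
near (0:R)^'+ => d; exists d => // t s s' tT sT ss'.
have : forall x : R * R, (`[0, T] `*` `[0, T]) x ->
  forall s', `|x.2 - s'| < d -> `|G x.1 x.2 - G x.1 s'| <= e by near: d.
by move=> /(_ (t, s)); apply => //; split => /=; rewrite in_itv.
Unshelve. all: by end_near.
Qed.

End uniform_continuity.

Section riemann_sums.
Context {R : realType} {V : normedModType R}.
Implicit Types (F G : R -> V).

Definition riemann_sum F n (x y : nat -> R) : V :=
  \sum_(i < n) (x i.+1 - x i) *: F (y i).

Definition tagged_partition (t delta : R) n (x y : nat -> R) :=
  [/\ x 0%N = 0, x n = t & forall i, (i < n)%N ->
    [/\ x i <= y i, y i <= x i.+1 & x i.+1 - x i < delta]].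

Lemma tagged_partition_mono t delta n x y : tagged_partition t delta n x y ->
  forall i j, (i <= j)%N -> (j <= n)%N -> x i <= x j.
Proof.
move=> [_ _ xy] i; elim => [|j IH]; first by rewrite leqn0 => /eqP->.
rewrite leq_eqVlt => /predU1P[->//|]; rewrite ltnS => ij jn.
have [h1 h2 _] := xy _ jn; apply: le_trans (le_trans h1 h2).
by apply: IH => //; exact: ltnW.
Qed.

Lemma tagged_partition_itv t delta n x y : tagged_partition t delta n x y ->
  forall i, (i < n)%N -> 0 <= y i <= t.
Proof.
move=> P i iltn; have mono := tagged_partition_mono P.
have [x0 xn xy] := P; have [h1 h2 _] := xy _ iltn.
rewrite (le_trans _ h1) ?(le_trans h2)//; first by rewrite -xn mono.
by rewrite -x0 mono// ltnW.
Qed.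

Definition uniform_grid (t : R) n (i : nat) : R := t * i%:R / n%:R.

Lemma uniform_grid_tagged (t delta : R) n : 0 <= t -> t / n.+1%:R < delta ->
  tagged_partition t delta n.+1 (uniform_grid t n.+1) (uniform_grid t n.+1).
Proof.
move=> t0 td; split => [||i _]; rewrite /uniform_grid.
- by rewrite mulr0 mul0r.
- by rewrite mulfK// pnatr_eq0.
have E : t * i.+1%:R / n.+1%:R - t * i%:R / n.+1%:R = t / n.+1%:R.
  by rewrite -mulrBl -mulrBr -natrB// subSnn mulr1.
split => //; last by rewrite E.
by rewrite -subr_ge0 E divr_ge0.
Qed.

Lemma uniform_grid_mesh (t delta : R) : 0 < delta -> \forall n \near \oo, t / n.+1%:R < delta.
Proof.
move=> d0; have c0 : (fun n : nat => t / n.+1%:R) @ \oo --> 0.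
  by rewrite -(mulr0 t); apply: cvgM; [exact: cvg_cst|exact: cvg_harmonic].
by move/cvgr_lt : c0; apply.
Qed.

Lemma is_RintegralP F t I : is_Rintegral F 0 t I <->
  forall e, 0 < e -> exists2 delta : R, 0 < delta &
    forall n x y, tagged_partition t delta n x y -> `|riemann_sum F n x y - I| < e.
Proof.
split=> FI e e0; have [delta d0 dI] := FI e e0; exists delta => // n x y.
  by move=> [x0 xn xy]; exact: dI.
by move=> x0 xn xy; apply: dI.
Qed.

Lemma eq_is_Rintegral F G t I : (forall s, 0 <= s <= t -> F s = G s) ->
  is_Rintegral F 0 t I -> is_Rintegral G 0 t I.
Proof.
move=> FG /is_RintegralP FI; apply/is_RintegralP => e e0.
have [delta d0 dI] := FI e e0; exists delta => // n x y P.
rewrite (_ : riemann_sum G n x y = riemann_sum F n x y); first exact: dI.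
apply: eq_bigr => i _; congr (_ *: _); apply/esym/FG.
exact: tagged_partition_itv P _ (ltn_ord i).
Qed.

Lemma is_RintegralB F G t I J :
  is_Rintegral F 0 t I -> is_Rintegral G 0 t J ->
  is_Rintegral (fun s => F s - G s) 0 t (I - J).
Proof.
move=> /is_RintegralP FI /is_RintegralP GJ; apply/is_RintegralP => e e0.
have e20 : 0 < e / 2 by rewrite divr_gt0.
have [d1 d10 dI] := FI _ e20; have [d2 d20 dJ] := GJ _ e20.
exists (Num.min d1 d2) => [|n x y [x0 xn xy]]; first by rewrite lt_min d10.
have P1 : tagged_partition t d1 n x y.
  by split => // i /xy[? ?]; rewrite lt_min => /andP[].
have P2 : tagged_partition t d2 n x y.
  by split => // i /xy[? ?]; rewrite lt_min => /andP[].
rewrite (_ : _ - _ = (riemann_sum F n x y - I) - (riemann_sum G n x y - J)).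
  by rewrite (splitr e) (le_lt_trans (ler_normB _ _))// ltrD// ?dI ?dJ.
rewrite /riemann_sum; under eq_bigr do rewrite scalerBr.
by rewrite big_split/= sumrN !opprB addrACA [RHS]addrACA; congr (_ + _); exact: addrC.
Qed.

Lemma is_Rintegral_cvg F t I : 0 <= t -> is_Rintegral F 0 t I ->
  (fun n => riemann_sum F n.+1 (uniform_grid t n.+1) (uniform_grid t n.+1)) @ \oo --> I.
Proof.
move=> t0 /is_RintegralP FI; apply/cvgrPdist_lt => e e0.
have [delta d0 dI] := FI e e0.
apply: filterS (uniform_grid_mesh t d0) => n td.
by rewrite distrC; apply: dI; exact: uniform_grid_tagged.
Qed.

Lemma is_Rintegral0 F I : is_Rintegral F 0 0 I -> I = 0.
Proof.
move=> FI; apply/eqP; rewrite -normr_eq0 -[_ == 0]negbK -normr_gt0 normr_id; apply/negP => I0.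
(* A partition without cells is admissible on a degenerate interval, and its sum is 0; the tolerance
   is the norm of [I] itself. *)
have [delta d0 /(_ 0%N (fun=> 0) (fun=> 0) erefl erefl)] := FI _ I0.
by rewrite big_ord0 (sub0r I) normrN ltxx => abs; suff : false by []; exact: abs.
Qed.

End riemann_sums.

Section scalar_riemann_sums.
Context {R : realType}.
Local Notation mu := (@lebesgue_measure R).

Lemma riemann_sum_dist_integral (g : R -> R) (t delta e : R) n x y :
  continuous g ->
  (forall s s', 0 <= s <= t -> 0 <= s' <= t -> `|s - s'| < delta -> `|g s - g s'| <= e) ->
  tagged_partition t delta n x y ->
  `|riemann_sum (g : R -> R^o) n x y - \int[mu]_(s in `[0, t]) g s| <= e * t.
Proof.
move=> cg unif P; have mono := tagged_partition_mono P; have [x0 xn xy] := P.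
have ig a b : mu.-integrable `[a, b] (EFin \o g).
  by apply: continuous_compact_integrable; [exact: segment_compact|exact: continuous_subspaceT].
have ic (c a b : R) : mu.-integrable `[a, b] (EFin \o (fun=> c)).
  apply: continuous_compact_integrable; first exact: segment_compact.
  by apply: continuous_subspaceT => ?; exact: cvg_cst.
suff H j : (j <= n)%N ->
    `|riemann_sum (g : R -> R^o) j x y - \int[mu]_(s in `[0, x j]) g s| <= e * x j.
  by rewrite -xn; exact: H.
elim: j => [|j IH] jn.
  by rewrite /riemann_sum big_ord0 x0 set_itv1 Rintegral_set1 subrr normr0 mulr0.
have xj0 : 0 <= x j by rewrite -x0 mono// ltnW.
have [h1 h2 h3] := xy _ jn.
have xjj := le_trans h1 h2.
have xjt : x j.+1 <= t by rewrite -xn mono.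
have := Rintegral_itvB (ig 0 (x j.+1)) (_ : BLeft 0 <= BRight (x j))%O
  (_ : BRight (x j) <= BRight (x j.+1))%O.
rewrite !bnd_simp Rintegral_itv_obnd_cbnd; last first.
  by apply: integrableS (ig (x j) (x j.+1)) => //; apply: subset_itvr; rewrite bnd_simp.
move=> /(_ xj0 xjj) split_int.
have cstE (c : R) : \int[mu]_(s in `[x j, x j.+1]) c = (x j.+1 - x j) * c.
  rewrite Rintegral_cst//= lebesgue_measure_itv/= lte_fin.
  move: xjj; rewrite le_eqVlt => /predU1P[->|->]/=; first by rewrite subrr ltxx mulr0 mul0r.
  by rewrite mulrC.
have piece : `|(x j.+1 - x j) * g (y j) - \int[mu]_(s in `[x j, x j.+1]) g s| <=
    e * (x j.+1 - x j).
  rewrite -cstE -RintegralB//.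
  apply: (le_trans (le_normr_Rintegral _ _)) => //.
    rewrite (_ : _ \o _ = (EFin \o (fun=> g (y j))) \- (EFin \o g))%E; last first.
      by apply/funext => s /=; rewrite EFinB.
    exact: integrableB.
  rewrite [leRHS]mulrC -cstE; apply: le_Rintegral => //.
    apply: continuous_compact_integrable; first exact: segment_compact.
    apply: continuous_subspaceT => s; apply: cvg_norm.
    by apply: cvgB; [exact: cvg_cst|exact: cg].
  move=> s; rewrite /= in_itv/= => /andP[sj sj']; apply: unif.
  - by apply/andP; split; lra.
  - by apply/andP; split; lra.
  - by rewrite ltr_norml; apply/andP; split; lra.
rewrite /riemann_sum big_ord_recr/= -[X in `|X|]/(_ : R).
have -> : e * x j.+1 = e * x j + e * (x j.+1 - x j) by ring.
apply: le_trans (lerD (IH (ltnW jn)) piece).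
apply: le_trans (ler_normD _ _); rewrite le_eqVlt; apply/orP; left; apply/eqP.
congr `|_|; rewrite -split_int /riemann_sum /GRing.scale/=; ring.
Qed.

End scalar_riemann_sums.

Record hilbert_inner_product {R : realType} {H : normedModType R}
    (ip : H -> H -> R) : Prop := HilbertInnerProduct {
  hip_addl : forall u v w, ip (u + v) w = ip u w + ip v w ;
  hip_scalel : forall a u v, ip (a *: u) v = a * ip u v ;
  hip_sym : forall u v, ip u v = ip v u ;
  hip_norm : forall u, ip u u = `|u| ^+ 2 ;
  hip_complete : forall u : nat -> H,
    (forall e : R, 0 < e ->
      exists N, forall m n, (N <= m)%N -> (N <= n)%N -> `|u m - u n| <= e) ->
    exists l : H, u @ \oo --> l }.

Section hilbert.
Context {R : realType} {H : normedModType R} (ip : H -> H -> R).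
Hypothesis hip : hilbert_inner_product ip.

Let ipDl := hip_addl hip.
Let ipZl := hip_scalel hip.
Let ipC := hip_sym hip.
Let ipE := hip_norm hip.

Lemma ip0l v : ip 0 v = 0.
Proof. by rewrite -(scale0r 0) ipZl mul0r. Qed.

Lemma ipNl u v : ip (- u) v = - ip u v.
Proof. by rewrite -scaleN1r ipZl mulN1r. Qed.

Lemma ipBl u v w : ip (u - v) w = ip u w - ip v w.
Proof. by rewrite ipDl ipNl. Qed.

Lemma ipBr u v w : ip u (v - w) = ip u v - ip u w.
Proof. by rewrite !(ipC u) ipBl. Qed.

Lemma ipZr a u v : ip u (a *: v) = a * ip u v.
Proof. by rewrite !(ipC u) ipZl. Qed.

Lemma ip_suml n (F : 'I_n -> H) v : ip (\sum_(i < n) F i) v = \sum_(i < n) ip (F i) v.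
Proof. by apply: (big_morph (ip^~ v)) => [u w|]; [exact: ipDl|exact: ip0l]. Qed.

Lemma cauchy_schwarz u v : `|ip u v| <= `|u| * `|v|.
Proof.
have [->|v0] := eqVneq v 0; first by rewrite ipC ip0l !normr0 mulr0.
have nv : 0 < `|v| ^+ 2 by rewrite exprn_gt0// normr_gt0.
rewrite -(@ler_pXn2r _ 2)// ?nnegrE ?mulr_ge0// real_normK ?num_real// exprMn.
rewrite -subr_ge0.
have -> : `|u| ^+ 2 * `|v| ^+ 2 - ip u v ^+ 2 =
    `|v| ^+ 2 * `|u - (ip u v / `|v| ^+ 2) *: v| ^+ 2.
  rewrite -(ipE (u - _)) ipBl !ipBr !ipZl !ipZr !ipE (ipC v u).
  by field; rewrite normr_eq0.
by rewrite mulr_ge0// sqr_ge0.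
Qed.

(** Testing against the difference [w] of the two sums reduces to a scalar function, whose two sums
    are each within [e * |w| * t] of the same Lebesgue integral; then [ip w w] returns the norm.
    This replaces a common refinement of the partitions. *)
Lemma riemann_sum_dist (F : R -> H) (t delta e : R) n x y m x' y' :
  0 <= t -> 0 <= e -> continuous F ->
  (forall s s', 0 <= s <= t -> 0 <= s' <= t -> `|s - s'| < delta -> `|F s - F s'| <= e) ->
  tagged_partition t delta n x y -> tagged_partition t delta m x' y' ->
  `|riemann_sum F n x y - riemann_sum F m x' y'| <= 2 * e * t.
Proof.
move=> t0 e0 cF unif P P'; set w := _ - _.
have [->|w0] := eqVneq w 0.
  by rewrite normr0 !mulr_ge0.
have nw : 0 < `|w| by rewrite normr_gt0.
pose g s := ip (F s) w.
have cg : continuous g.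
  move=> s; apply/cvgrPdist_le => e' e'0.
  have /cvgrPdist_le /(_ (e' / `|w|)) := cF s.
  rewrite divr_gt0// => /(_ isT); apply: filterS => s' ss'.
  rewrite /g -ipBl (le_trans (cauchy_schwarz _ _))//.
  by rewrite -ler_pdivlMr.
have gunif s s' : 0 <= s <= t -> 0 <= s' <= t -> `|s - s'| < delta -> `|g s - g s'| <= e * `|w|.
  move=> st s't ss'; rewrite /g -ipBl (le_trans (cauchy_schwarz _ _))//.
  by rewrite ler_wpM2r// unif.
have ipsum k (z z' : nat -> R) : ip (riemann_sum F k z z') w = riemann_sum (g : R -> R^o) k z z'.
  by rewrite ip_suml; apply: eq_bigr => i _; rewrite ipZl.
have h1 := riemann_sum_dist_integral cg gunif P.
have h2 := riemann_sum_dist_integral cg gunif P'.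
have : `|w| * `|w| <= (2 * e * t) * `|w|.
  rewrite -expr2 -ipE {1}/w ipBl !ipsum.
  rewrite (le_trans (ler_norm _))//.
  rewrite (le_trans (ler_distD (\int[@lebesgue_measure R]_(s in `[0, t]) g s) _ _))//.
  have -> : 2 * e * t * `|w| = e * `|w| * t + e * `|w| * t by ring.
  by rewrite lerD// distrC.
by rewrite ler_pM2r.
Qed.

Lemma riemann_sum_dist_Rintegral (F : R -> H) (t delta e : R) n x y I :
  0 <= t -> 0 <= e -> 0 < delta -> continuous F ->
  (forall s s', 0 <= s <= t -> 0 <= s' <= t -> `|s - s'| < delta -> `|F s - F s'| <= e) ->
  tagged_partition t delta n x y -> is_Rintegral F 0 t I ->
  `|riemann_sum F n x y - I| <= 2 * e * t.
Proof.
move=> t0 e0 d0 cF unif P FI; apply/ler_addgt0Pr => r r0.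
pose u m := riemann_sum F m.+1 (uniform_grid t m.+1) (uniform_grid t m.+1).
have /cvgrPdist_lt /(_ _ r0) near1 : u @ \oo --> I := is_Rintegral_cvg t0 FI.
near \oo => m.
apply: (le_trans (ler_distD (u m) _ _)); apply: lerD.
  apply: (riemann_sum_dist t0 e0 cF unif P).
  by apply: uniform_grid_tagged => //; near: m; exact: uniform_grid_mesh.
by rewrite distrC ltW//; near: m.
Unshelve. all: by end_near.
Qed.

Lemma Rintegral_exists (F : R -> H) (t : R) : 0 <= t -> continuous F ->
  exists I, is_Rintegral F 0 t I.
Proof.
move=> t0 cF.
have unif (e : R) : 0 < e -> exists2 delta : R, 0 < delta &
    forall s s', 0 <= s <= t -> 0 <= s' <= t -> `|s - s'| < delta -> `|F s - F s'| <= e.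
  move=> e0; have cG : continuous (fun x : R * R => F x.2).
    by move=> x; apply: (@continuous_comp _ _ _ snd F); [exact: cvg_snd|exact: cF].
  have [delta d0 dF] := @unif_continuous_param _ _ (fun=> F) t e e0 cG.
  by exists delta => // s s' st _ ss'; apply: (dF t) => //; rewrite t0 lexx.
pose u n := riemann_sum F n.+1 (uniform_grid t n.+1) (uniform_grid t n.+1).
(* Dividing by [t + 1] instead of [t] keeps the tolerance positive at [t = 0]. *)
have e_small (r : R) : 0 < r -> 2 * (r / (2 * (t + 1))) * t <= r.
  move=> r0; have -> : 2 * (r / (2 * (t + 1))) * t = r * (t / (t + 1)).
    by field; rewrite gt_eqF//; lra.
  by rewrite ler_piMr ?(ltW r0)// ler_pdivrMr; lra.
have e_pos (r : R) : 0 < r -> 0 < r / (2 * (t + 1)).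
  by move=> r0; rewrite divr_gt0// mulr_gt0//; lra.
have [I uI] : exists I : H, u @ \oo --> I.
  apply: (hip_complete hip) => r r0.
  have [delta d0 dF] := unif _ (e_pos _ r0).
  have [N _ NP] := uniform_grid_mesh t d0.
  exists N => m n Nm Nn; apply: le_trans (e_small r r0).
  by apply: riemann_sum_dist => //; [exact/ltW/e_pos|exact: dF|..];
    apply: uniform_grid_tagged => //; exact: NP.
exists I; apply/is_RintegralP => r r0.
have r20 : 0 < r / 2 by rewrite divr_gt0.
have [delta d0 dF] := unif _ (e_pos _ r20).
exists delta => // n x y P.
have /cvgrPdist_lt /(_ _ r20) near1 := uI.
near \oo => m.
rewrite (splitr r) (le_lt_trans (ler_distD (u m) _ _))//; apply: ler_ltD; last first.
  by rewrite distrC; near: m.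
apply: le_trans (e_small _ r20).
apply: riemann_sum_dist => //; [exact/ltW/e_pos|exact: dF|exact: P|].
by apply: uniform_grid_tagged => //; near: m; exact: uniform_grid_mesh.
Unshelve. all: by end_near.
Qed.

End hilbert.

(** * Evolution families and the Duhamel integral *)

Section limits.
Context {R : realType} {V : normedModType R}.

Lemma cvg_norm_le (u : nat -> V) (l : V) (c : R) : u @ \oo --> l ->
  (\forall n \near \oo, `|u n| <= c) -> `|l| <= c.
Proof.
move=> ul uc; rewrite leNgt; apply/negP => cl.
have gtc : \forall n \near \oo, c < `|u n| by exact: (cvgr_norm_gt _ ul _ cl).
near \oo => n.
have : c < `|u n| by near: n.
by rewrite ltNge => /negP; apply; near: n.
Unshelve. all: by end_near.
Qed.

Lemma continuous_sum {X : topologicalType} n (f : nat -> X -> V) :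
  (forall i, continuous (f i)) -> continuous (fun x => \sum_(i < n) f i x).
Proof.
move=> cf; elim: n => [|n IH] x.
  by under [X in continuous_at _ X]eq_fun do rewrite big_ord0; exact: cvg_cst.
under [X in continuous_at _ X]eq_fun do rewrite big_ord_recr/=.
by apply: cvgD; [exact: IH|exact: cf].
Qed.

End limits.

Section evolution_family.
Context {R : realType} {H : normedModType R}.

(** What remains of the resolvent in the abstract argument: [w] stands for the first relaxation
    function and [L] for [lambda_1]. The last field is the bound [1 / L] on the integral of [w], in
    the form in which it meets Riemann sums. *)
Record evolution_family (S : R -> H -> H) (w : R -> R) (L : R) : Prop := EvolutionFamily {
  evolution_sub : forall (t : R) u v, 0 <= t -> S t (u - v) = S t u - S t v ;
  evolution_id : forall v, S 0 v = v ;
  evolution_norm : forall (t : R) v, 0 <= t -> `|S t v| <= w t * `|v| ;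
  evolution_continuous : forall v, continuous (fun t : R => S (Num.max 0 t) v) ;
  weight_ge0 : forall t : R, 0 <= t -> 0 <= w t ;
  weight_le1 : forall t : R, 0 <= t -> w t <= 1 ;
  weight_nonincreasing : forall s t : R, 0 <= s -> s <= t -> w t <= w s ;
  weight_rate_gt0 : 0 < L ;
  weight_decay : forall t : R, 0 <= t -> L * (t * w t) <= 1 ;
  weight_left_sum : forall (t : R) n (x : nat -> R), x 0%N = 0 -> x n = t ->
    (forall i, (i < n)%N -> x i <= x i.+1) ->
    L * \sum_(i < n) (x i.+1 - x i) * w (t - x i) <= 1 }.

End evolution_family.

Lemma continuous_pair {X Y Z : topologicalType} (f : X -> Y) (g : X -> Z) :
  continuous f -> continuous g -> continuous (fun x => (f x, g x)).
Proof. by move=> cf cg x; apply: (cvg_pair (cf x) (cg x)). Qed.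

Lemma continuous_max0 {R : realType} : continuous (fun t : R => Num.max 0 t).
Proof.
move=> t; apply: (@continuous_max R R^o (fun=> 0) (fun t => t) t).
  exact: cvg_cst.
exact: cvg_id.
Qed.

Section duhamel.
Context {R : realType} {H : normedModType R} (ip : H -> H -> R).
Hypothesis hip : hilbert_inner_product ip.
Context (S : R -> H -> H) (w : R -> R) (L : R).
Hypothesis Sw : evolution_family S w L.

Let max0_ge0 (t : R) : 0 <= Num.max 0 t. Proof. by rewrite le_max lexx. Qed.

Lemma evolution_norm1 (t : R) v : 0 <= t -> `|S t v| <= `|v|.
Proof.
move=> t0; apply: (le_trans (evolution_norm Sw v t0)).
by rewrite ler_piMl// (weight_le1 Sw).
Qed.

Lemma evolution_jointly_continuous :
  continuous (fun x : R * H => S (Num.max 0 x.1) x.2).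
Proof.
move=> [t v]; apply/cvgrPdist_lt => e e0 /=.
have e20 : 0 < e / 2 by rewrite divr_gt0.
have /cvgrPdist_lt /(_ _ e20) near_t := @evolution_continuous _ _ _ _ _ Sw v t.
near=> x.
rewrite (splitr e) (le_lt_trans (ler_distD (S (Num.max 0 x.1) v) _ _))// ltrD//.
  by near: x; exact: (cvg_fst near_t).
rewrite -(evolution_sub Sw)// (le_lt_trans (evolution_norm1 _ _))//.
near: x; have : \forall y \near v, `|v - y| < e / 2.
  by apply/nbhs_normP; exists (e / 2).
exact: cvg_snd.
Unshelve. all: by end_near.
Qed.

Lemma duhamel_integrand_continuous (F : R -> H) : continuous F ->
  continuous (fun x : R * R => S (Num.max 0 (x.1 - x.2)) (F x.2)).
Proof.
move=> cF x.
apply: (@continuous_comp _ _ _ (fun x : R * R => (x.1 - x.2, F x.2))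
  (fun y : R * H => S (Num.max 0 y.1) y.2)); last exact: evolution_jointly_continuous.
apply: continuous_pair => y; first by apply: cvgB; [exact: cvg_fst|exact: cvg_snd].
by apply: (@continuous_comp _ _ _ snd F); [exact: cvg_snd|exact: cF].
Qed.

Let integrand_continuous (t : R) (F : R -> H) : continuous F ->
  continuous (fun s : R => S (Num.max 0 (t - s)) (F s)).
Proof.
move=> cF s; apply: (@continuous_comp _ _ _ (fun s : R => (t, s))
  (fun x : R * R => S (Num.max 0 (x.1 - x.2)) (F x.2))); last exact: duhamel_integrand_continuous.
by apply: continuous_pair => y; [exact: cvg_cst|exact: cvg_id].
Qed.

Let max_sub (t s : R) : 0 <= s <= t -> Num.max 0 (t - s) = t - s.
Proof. by move=> /andP[_ st]; apply/max_idPr; rewrite subr_ge0. Qed.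

Definition duhamel (F : R -> H) (t : R) : H :=
  xget 0 [set I | is_Rintegral (fun s => S (t - s) (F s)) 0 t I].

Lemma duhamelP (F : R -> H) (t : R) : continuous F -> 0 <= t ->
  is_Rintegral (fun s => S (t - s) (F s)) 0 t (duhamel F t).
Proof.
move=> cF t0; rewrite /duhamel; apply: xgetPex.
have [I FI] := Rintegral_exists hip t0 (@integrand_continuous t F cF).
exists I; apply: eq_is_Rintegral FI => s st.
by rewrite max_sub.
Qed.

Lemma duhamel0 (F : R -> H) : continuous F -> duhamel F 0 = 0.
Proof. by move=> cF; apply: is_Rintegral0; exact: duhamelP. Qed.

(** Sums over a grid that scales with [[0, t]] are continuous in [t] and approximate the integral
    uniformly for bounded [t], so integrals over different intervals need not be compared. *)
Lemma duhamel_continuous (F : R -> H) : continuous F ->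
  continuous (fun t : R => duhamel F (Num.max 0 t)).
Proof.
move=> cF t0; apply/cvgrPdist_lt => e e0.
pose T := Num.max 0 t0 + 1.
have T0 : 0 < T by rewrite ltr_wpDl.
(* Then [2 * r * T = e / 3], one third of the tolerance for each of the two approximations. *)
pose r := e / (6 * T).
have r0 : 0 < r by rewrite divr_gt0// mulr_gt0.
have [delta d0 unif] :=
  @unif_continuous_param _ _ (fun t s => S (Num.max 0 (t - s)) (F s)) T r r0
    (duhamel_integrand_continuous cF).
near \oo => n.
pose u (t : R) := riemann_sum (fun s => S (Num.max 0 (t - s)) (F s)) n.+1
  (uniform_grid t n.+1) (uniform_grid t n.+1).
have uclose (t : R) : 0 <= t <= T -> `|u t - duhamel F t| <= e / 3.
  move=> tT; have /andP[t_ge0 t_leT] := tT.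
  apply: (@le_trans _ _ (2 * r * t)); last first.
    have -> : e / 3 = 2 * r * T by rewrite /r; field; rewrite gt_eqF.
    by rewrite ler_wpM2l// mulr_ge0// ltW.
  apply: (riemann_sum_dist_Rintegral hip t_ge0 (ltW r0) d0 (@integrand_continuous t F cF)).
  - move=> s s' /andP[s0 st] _; apply: (unif t s s' tT); rewrite s0 /=; exact: le_trans t_leT.
  - apply: uniform_grid_tagged => //; apply: (@le_lt_trans _ _ (T / n.+1%:R)).
      by rewrite ler_wpM2r// invr_ge0.
    by near: n; exact: uniform_grid_mesh.
  - by apply: eq_is_Rintegral (duhamelP cF t_ge0) => s st; rewrite max_sub.
have cu : continuous (fun t : R => u (Num.max 0 t)).
  move=> t; apply: (@continuous_comp _ _ _ (fun t : R => Num.max 0 t) u); first exact: continuous_max0.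
  have cgrid i : continuous (fun t : R => uniform_grid t n.+1 i).
    by move=> s; apply: cvgM; [apply: cvgM; [exact: cvg_id|exact: cvg_cst]|exact: cvg_cst].
  apply: (@continuous_sum _ _ _ n.+1 (fun i t =>
    (uniform_grid t n.+1 i.+1 - uniform_grid t n.+1 i) *:
    S (Num.max 0 (t - uniform_grid t n.+1 i)) (F (uniform_grid t n.+1 i)))) => i s.
  apply: cvgZ; first by apply: cvgB; exact: cgrid.
  apply: (@continuous_comp _ _ _ (fun t : R => (t, uniform_grid t n.+1 i))
    (fun x : R * R => S (Num.max 0 (x.1 - x.2)) (F x.2))); last exact: duhamel_integrand_continuous.
  by apply: continuous_pair => y; [exact: cvg_id|exact: cgrid].
have e30 : 0 < e / 3 by rewrite divr_gt0.
have /cvgrPdist_lt /(_ _ e30) near_u := cu t0.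
near=> t.
have tT : 0 <= Num.max 0 t <= T.
  rewrite max0_ge0 /=; near: t.
  by have := @continuous_max0 R t0 => /cvgr_le; apply; rewrite ltrDl.
have t0T : 0 <= Num.max 0 t0 <= T by rewrite max0_ge0 /= lerDl.
have -> : e = e / 3 + (e / 3 + e / 3) by field.
apply: (le_lt_trans (ler_distD (u (Num.max 0 t0)) _ _)); rewrite ler_ltD//.
  by rewrite distrC uclose.
apply: (le_lt_trans (ler_distD (u (Num.max 0 t)) _ _)); rewrite ltr_leD//; last exact: uclose.
by near: t.
Unshelve. all: by end_near.
Qed.

(** The cells starting before [T] can overshoot it by one cell only, of length at most 1. *)
Let partial_mesh (x : nat -> R) n (T : R) : 0 <= T -> x 0%N = 0 ->
  (forall i, (i < n)%N -> x i <= x i.+1) ->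
  (forall i, (i < n)%N -> x i.+1 - x i <= 1) ->
  \sum_(i < n | x i < T) (x i.+1 - x i) <= T + 1.
Proof.
move=> T0 x0 xle x1.
suff H0 j : (j <= n)%N -> \sum_(i < j | x i < T) (x i.+1 - x i) <= Num.min (x j) (T + 1).
  by apply: (le_trans (H0 n (leqnn n))); rewrite ge_min lexx orbT.
elim: j => [|j IH] jn; first by rewrite big_ord0 x0 le_min lexx; lra.
have := IH (ltnW jn); have := xle _ jn; have := x1 _ jn.
rewrite [X in X <= Num.min (x j.+1) _]big_mkcond big_ord_recr/= -big_mkcond/= !le_min.
move=> h1 h2 /andP[h3 h4].
by case: ifPn => [xT|_]; apply/andP; split; lra.
Qed.

(* Left Riemann sums suffice: their tags never reach the endpoint t, and the weights
   w (t - x) are sampled where w is smallest. *)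
Lemma duhamel_bound (F : R -> H) (t T B C : R) I :
  0 <= T -> T <= t -> 0 <= B -> 0 <= C ->
  is_Rintegral (fun s => S (t - s) (F s)) 0 t I ->
  (forall s : R, 0 <= s -> s < t -> `|F s| <= B + C) ->
  (forall s : R, T <= s -> s < t -> `|F s| <= B) ->
  L * `|I| <= B + L * (C * (T + 1) * w (t - T)).
Proof.
move=> T0 Tt B0 C0 FI bnd1 bnd2; have L0 := weight_rate_gt0 Sw.
have t0 : 0 <= t := le_trans T0 Tt.
have wT0 : 0 <= w (t - T) by apply: (weight_ge0 Sw); rewrite subr_ge0.
have CT0 : 0 <= C * (T + 1) by rewrite mulr_ge0// addr_ge0.
move: t0; rewrite le_eqVlt => /predU1P[t00|t_gt0].
  have -> : I = 0 by move: FI; rewrite -t00; exact: is_Rintegral0.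
  by rewrite normr0 mulr0; apply: addr_ge0 => //; apply: mulr_ge0; [exact: ltW|exact: mulr_ge0].
have t0 := ltW t_gt0.
suff : `|I| <= B / L + C * (T + 1) * w (t - T).
  rewrite -(ler_pM2l L0) mulrDr [L * (B / L)]mulrC divfK//.
  by rewrite gt_eqF.
apply: (cvg_norm_le (is_Rintegral_cvg t0 FI)).
apply: filterS (uniform_grid_mesh t ltr01) => n mesh.
have [x0 xn xle] := uniform_grid_tagged t0 mesh.
set x := uniform_grid t n.+1 in x0 xn xle *.
have xmono i : (i < n.+1)%N -> x i <= x i.+1 by move=> /xle[].
have x_ge0 (i : 'I_n.+1) : 0 <= x i by rewrite divr_ge0// mulr_ge0.
have x_lt (i : 'I_n.+1) : x i < t.
  by rewrite /x /uniform_grid -mulrA gtr_pMr// ltr_pdivrMr// mul1r ltr_nat.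
have D_ge0 (i : 'I_n.+1) : 0 <= x i.+1 - x i by rewrite subr_ge0 xmono.
have w_ge0 (i : 'I_n.+1) : 0 <= w (t - x i) by rewrite (weight_ge0 Sw)// subr_ge0 ltW.
(* [B] is charged on every cell, the excess [C] only on cells starting before [T]; there
   [t - T <= t - x i], so the weight is at most [w (t - T)]. *)
have term (i : 'I_n.+1) : `|(x i.+1 - x i) *: S (t - x i) (F (x i))| <=
    (x i.+1 - x i) * w (t - x i) * B +
    (if x i < T then (x i.+1 - x i) * (C * w (t - T)) else 0).
  rewrite normrZ ger0_norm//.
  have h : `|S (t - x i) (F (x i))| <= w (t - x i) * `|F (x i)|.
    by apply: (evolution_norm Sw); rewrite subr_ge0 ltW.
  case: ifPn => [xT|]; last first.
    rewrite -leNgt => Tx; rewrite addr0 -mulrA ler_wpM2l//.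
    by apply: (le_trans h); rewrite ler_wpM2l// bnd2.
  rewrite -mulrA -mulrDr ler_wpM2l//; apply: (le_trans h).
  apply: (@le_trans _ _ (w (t - x i) * (B + C))); first by rewrite ler_wpM2l// bnd1.
  rewrite mulrDr lerD2l mulrC ler_wpM2l// (weight_nonincreasing Sw)//.
    by rewrite subr_ge0.
  by rewrite lerD2l lerN2 ltW.
apply: (le_trans (ler_norm_sum _ _ _)).
apply: (le_trans (ler_sum _ (fun i _ => term i))).
rewrite big_split/= -mulr_suml; apply: lerD.
  rewrite mulrC ler_wpM2l// -div1r ler_pdivlMr// mulrC.
  by apply: (weight_left_sum Sw).
rewrite -big_mkcond/= -mulr_suml.
have -> : C * (T + 1) * w (t - T) = (T + 1) * (C * w (t - T)) by ring.
rewrite ler_wpM2r//; first by rewrite mulr_ge0.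
by apply: partial_mesh => // i /xle[_ _ /ltW].
Qed.

Lemma duhamel_bound_uniform (F : R -> H) (t B : R) I : 0 <= t -> 0 <= B ->
  is_Rintegral (fun s => S (t - s) (F s)) 0 t I ->
  (forall s : R, 0 <= s -> s < t -> `|F s| <= B) -> L * `|I| <= B.
Proof.
move=> t0 B0 FI bnd.
have := @duhamel_bound F t 0 B 0 I (lexx 0) t0 B0 (lexx 0) FI.
by rewrite addr0 !mul0r mulr0 addr0; apply.
Qed.

Lemma duhamel_lipschitz (F G : R -> H) (t B : R) I J : 0 <= t -> 0 <= B ->
  is_Rintegral (fun s => S (t - s) (F s)) 0 t I ->
  is_Rintegral (fun s => S (t - s) (G s)) 0 t J ->
  (forall s : R, 0 <= s -> s < t -> `|F s - G s| <= B) -> L * `|I - J| <= B.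
Proof.
move=> t0 B0 FI GJ bnd.
apply: (@duhamel_bound_uniform (fun s => F s - G s) t) => //.
apply: eq_is_Rintegral (is_RintegralB FI GJ) => s /andP[s0 st].
by rewrite (evolution_sub Sw)// subr_ge0.
Qed.

End duhamel.

(** * Delay equations *)

Lemma geometric_small {R : realType} (q c e : R) : 0 <= q -> q < 1 -> 0 < e ->
  exists n, c * q ^+ n <= e.
Proof.
move=> q0 q1 e0.
have lim0 : (fun n => c * q ^+ n) @ \oo --> 0.
  rewrite -(mulr0 c); apply: cvgM; first exact: cvg_cst.
  by apply: cvg_expr; rewrite ger0_norm.
have /cvgr_le /(_ _ e0) [n _ /(_ n (leqnn n)) ne] := lim0.
by exists n.
Qed.

Section delay_equation.
Context {R : realType} {H : normedModType R} (ip : H -> H -> R).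
Hypothesis hip : hilbert_inner_product ip.
Context (S : R -> H -> H) (w : R -> R) (L : R).
Hypothesis Sw : evolution_family S w L.
Context (tau : R) (rho : R -> R) (f : R -> H -> H) (r M : R).
Hypothesis tau_ge0 : 0 <= tau.
Hypothesis f_continuous : continuous (fun x : R * H => f (Num.max 0 x.1) x.2).
Hypothesis lag_continuous : continuous (fun s : R => Num.max 0 s - rho (Num.max 0 s)).
Hypothesis lag_bound : forall t : R, 0 <= t -> - tau <= t - rho t <= t.
Hypothesis r_gt0 : 0 < r.
Hypothesis M_ge0 : 0 <= M.
Hypothesis M_lt : M < L.
Hypothesis f0 : forall t : R, 0 <= t -> f t 0 = 0.
Hypothesis f_lip : forall (t : R) v1 v2, 0 <= t -> `|v1| <= r -> `|v2| <= r ->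
  `|f t v1 - f t v2| <= M * `|v1 - v2|.

Let q := M / L.
Let L_gt0 : 0 < L := weight_rate_gt0 Sw.
Let q_ge0 : 0 <= q. Proof. by rewrite divr_ge0// ltW. Qed.
Let q_lt1 : q < 1. Proof. by rewrite ltr_pdivrMr// mul1r. Qed.
Let max0_ge0 (t : R) : 0 <= Num.max 0 t. Proof. by rewrite le_max lexx. Qed.
Let max0_id (t : R) : 0 <= t -> Num.max 0 t = t. Proof. by move=> /max_idPr. Qed.

Let f_bound (t : R) v : 0 <= t -> `|v| <= r -> `|f t v| <= M * `|v|.
Proof.
move=> t0 vr; have := f_lip t0 vr (_ : `|0| <= r).
by rewrite f0// !subr0 normr0; apply; exact: ltW.
Qed.

Let rate_le (x B : R) : L * x <= M * B -> x <= q * B.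
Proof. by move=> h; rewrite /q mulrAC ler_pdivlMr// mulrC. Qed.

Definition delay_mild_solution (xi u : R -> H) : Prop :=
  [/\ continuous (fun t : R => u (Num.max (- tau) t)),
      forall s : R, - tau <= s <= 0 -> u s = xi s &
      forall t : R, 0 <= t -> exists2 I : H,
        is_Rintegral (fun s => S (t - s) (f s (u (s - rho s)))) 0 t I &
        u t = S t (xi 0) + I].

(** * Existence by Picard iteration *)

Section existence.
Context (xi : R -> H).
Let xi0 (t : R) := xi (Num.max (- tau) (Num.min 0 t)).
Hypothesis xi_continuous : continuous xi0.
Hypothesis xi_bound : forall s : R, - tau <= s <= 0 -> `|xi s| <= (1 - q) * r.

Let xi0_nonneg (t : R) : 0 <= t -> xi0 t = xi 0.
Proof.
move=> t0; rewrite /xi0; congr xi.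
by rewrite (min_idPl t0); apply/max_idPr; rewrite oppr_le0.
Qed.

Let xi0_bound t : `|xi0 t| <= (1 - q) * r.
Proof.
apply: xi_bound; rewrite le_max lexx /= ge_max oppr_le0 tau_ge0 /=.
by rewrite ge_min lexx.
Qed.

Let source (u : R -> H) (s : R) :=
  f (Num.max 0 s) (u (Num.max 0 s - rho (Num.max 0 s))).

Let source_continuous u : continuous u -> continuous (source u).
Proof.
move=> cu s; apply: (@continuous_comp _ _ _
  (fun s : R => (s, u (Num.max 0 s - rho (Num.max 0 s))))
  (fun x : R * H => f (Num.max 0 x.1) x.2)); last exact: f_continuous.
apply: continuous_pair => y; first exact: cvg_id.
apply: (@continuous_comp _ _ _ (fun s : R => Num.max 0 s - rho (Num.max 0 s)) u).
  exact: lag_continuous.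
exact: cu.
Qed.

(* The first two terms vanish for t >= 0, the others cancel for t <= 0: this total
   formula makes the fixed-point map manifestly continuity preserving. *)
Let Phi (u : R -> H) (t : R) :=
  xi0 t - xi 0 + S (Num.max 0 t) (xi 0) + duhamel S (source u) (Num.max 0 t).

Let Phi_continuous u : continuous u -> continuous (Phi u).
Proof.
move=> cu t; apply: cvgD.
  apply: cvgD; first by apply: cvgB; [exact: xi_continuous|exact: cvg_cst].
  exact: (@evolution_continuous _ _ _ _ _ Sw (xi 0) t).
exact: (@duhamel_continuous _ _ _ hip _ _ _ Sw (source u) (source_continuous cu) t).
Qed.

Let Phi_nonpos u t : continuous u -> t <= 0 -> Phi u t = xi0 t.
Proof.
move=> cu t0; rewrite /Phi (max_idPl t0) (evolution_id Sw).
by rewrite (duhamel0 hip Sw (source_continuous cu)) addr0 subrK.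
Qed.

Let Phi_nonneg u t : 0 <= t -> Phi u t = S t (xi 0) + duhamel S (source u) t.
Proof. by move=> t0; rewrite /Phi xi0_nonneg// subrr add0r (max0_id t0). Qed.

Let admissible (u : R -> H) := continuous u /\ forall s, `|u s| <= r.

Let xi_0_bound : `|xi 0| <= (1 - q) * r.
Proof. by rewrite -(xi0_nonneg (lexx 0)). Qed.

Let Phi_admissible u : admissible u -> admissible (Phi u).
Proof.
move=> [cu ur]; split; first exact: Phi_continuous.
move=> t; have [t0|/ltW t0] := leP t 0.
  rewrite Phi_nonpos//; apply: (le_trans (xi0_bound t)).
  by rewrite ler_piMl ?(ltW r_gt0)// gerBl.
rewrite Phi_nonneg// (le_trans (ler_normD _ _))//.
(* The initial datum uses the share [(1 - q) * r] of the radius, the Duhamel term the share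
   [q * r]. *)
have -> : r = (1 - q) * r + q * r by ring.
apply: lerD; first exact: le_trans (evolution_norm1 Sw _ t0) xi_0_bound.
apply: rate_le.
apply: (duhamel_bound_uniform Sw t0 _ (duhamelP hip Sw (source_continuous cu) t0)).
  by rewrite mulr_ge0// ltW.
move=> s s0 st; apply: (le_trans (f_bound (max0_ge0 s) (ur _))).
by rewrite ler_wpM2l.
Qed.

Let Phi_contraction u v D : admissible u -> admissible v ->
  (forall s, `|u s - v s| <= D) -> forall t, `|Phi u t - Phi v t| <= q * D.
Proof.
move=> [cu ur] [cv vr] uvD t.
have D0 : 0 <= D by apply: le_trans (uvD 0).
have [t0|/ltW t0] := leP t 0.
  by rewrite !Phi_nonpos// subrr normr0 mulr_ge0.
rewrite !Phi_nonneg// opprD addrACA subrr add0r.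
apply: rate_le.
apply: (duhamel_lipschitz Sw t0 _ (duhamelP hip Sw (source_continuous cu) t0)
  (duhamelP hip Sw (source_continuous cv) t0)); first by rewrite mulr_ge0.
move=> s s0 st; apply: (le_trans (f_lip (max0_ge0 s) (ur _) (vr _))).
by rewrite ler_wpM2l.
Qed.

Let picard n := iter n Phi xi0.

Let picard_admissible n : admissible (picard n).
Proof.
elim: n => [|n IH]; last exact: Phi_admissible.
split=> // s; apply: (le_trans (xi0_bound s)).
by rewrite ler_piMl ?(ltW r_gt0)// gerBl.
Qed.

Let picard_step n t : `|picard n.+1 t - picard n t| <= q ^+ n * (2 * r).
Proof.
elim: n t => [|n IH] t.
  rewrite expr0 mul1r mulr_natl (le_trans (ler_normB _ _))//.
  by rewrite mulr2n lerD//; [exact: (picard_admissible 1).2|exact: (picard_admissible 0).2].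
rewrite exprS -mulrA.
exact: (Phi_contraction (picard_admissible n.+1) (picard_admissible n) IH).
Qed.

(** The sum of the geometric series that bounds all Picard increments. *)
Let c := 2 * r / (1 - q).
Let c_ge0 : 0 <= c. Proof. by rewrite divr_ge0 ?subr_ge0 ?(ltW q_lt1)// mulr_ge0// ltW. Qed.

Let picard_dist n m t : `|picard (n + m) t - picard n t| <= c * q ^+ n.
Proof.
(* The telescoping form is stable under induction on [m], which the final bound is not. *)
suff h : `|picard (n + m) t - picard n t| <= c * (q ^+ n - q ^+ (n + m)).
  by apply: (le_trans h); rewrite ler_wpM2l// gerBl exprn_ge0.
elim: m => [|m IH]; first by rewrite addn0 !subrr normr0 mulr0.
rewrite addnS (le_trans (ler_distD (picard (n + m) t) _ _))//.
have -> : c * (q ^+ n - q ^+ (n + m).+1) =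
    q ^+ (n + m) * (2 * r) + c * (q ^+ n - q ^+ (n + m)).
  by rewrite exprS /c; field; rewrite subr_eq0 gt_eqF.
exact: lerD.
Qed.

Let picard_cvg t : exists l : H, (fun n => picard n t) @ \oo --> l.
Proof.
apply: (hip_complete hip) => e e0.
have e20 : 0 < e / 2 by rewrite divr_gt0.
have [N cN] := geometric_small c q_ge0 q_lt1 e20.
exists N => m n Nm Nn.
rewrite (splitr e) (le_trans (ler_distD (picard N t) _ _))// lerD//.
  by rewrite -(subnKC Nm); exact: le_trans cN.
by rewrite distrC -(subnKC Nn); exact: le_trans cN.
Qed.

Let u t := projT1 (cid (picard_cvg t)).

Let uP t : (fun n => picard n t) @ \oo --> u t.
Proof. by rewrite /u; case: cid. Qed.

Let u_dist n t : `|u t - picard n t| <= c * q ^+ n.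
Proof.
apply: (@cvg_norm_le _ _ (fun m => picard m t - picard n t)).
  by apply: cvgB; [exact: uP|exact: cvg_cst].
by exists n => // m /= nm; rewrite -(subnKC nm).
Qed.

Let u_admissible : admissible u.
Proof.
split; last first.
  move=> s; have ev : \forall n \near \oo, `|picard n s| <= r.
    by apply: nearW => n; exact: (picard_admissible n).2.
  exact: (cvg_norm_le (@uP s) ev).
move=> t; apply/cvgrPdist_lt => e e0.
have e30 : 0 < e / 3 by rewrite divr_gt0.
have [n cn] := geometric_small c q_ge0 q_lt1 e30.
have /cvgrPdist_lt /(_ _ e30) := (picard_admissible n).1 t.
apply: filterS => s ps.
have -> : e = e / 3 + (e / 3 + e / 3) by field.
rewrite (le_lt_trans (ler_distD (picard n t) _ _))// ler_ltD//.
  exact: le_trans cn.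
rewrite (le_lt_trans (ler_distD (picard n s) _ _))// ltr_leD//.
by rewrite distrC; exact: le_trans cn.
Qed.

Let u_fixed t : Phi u t = u t.
Proof.
apply/eqP; rewrite -subr_eq0 -normr_le0; apply/ler_addgt0Pr => e e0; rewrite add0r.
have e20 : 0 < e / 2 by rewrite divr_gt0.
have [n cn] := geometric_small c q_ge0 q_lt1 e20.
have q_mul (x : R) : 0 <= x -> q * x <= x by move=> x0; rewrite ler_piMl// ltW.
have cq0 : 0 <= c * q ^+ n by rewrite mulr_ge0// exprn_ge0.
rewrite (splitr e) (le_trans (ler_distD (picard n.+1 t) _ _))// lerD//.
  apply: (le_trans (Phi_contraction u_admissible (picard_admissible n) (u_dist n) t)).
  exact: le_trans (q_mul _ cq0) cn.
rewrite distrC; apply: (le_trans (u_dist n.+1 t)).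
by rewrite exprS mulrCA; exact: le_trans (q_mul _ cq0) cn.
Qed.

Lemma delay_mild_solution_exists : exists u, delay_mild_solution xi u.
Proof.
have [cu ur] := u_admissible.
exists u; split.
- move=> t; apply: (@continuous_comp _ _ _ (fun t : R => Num.max (- tau) t) u); last exact: cu.
  apply: (@continuous_max R R^o (fun=> - tau) (fun t => t) t); first exact: cvg_cst.
  exact: cvg_id.
- move=> s /andP[taus s0]; rewrite -u_fixed Phi_nonpos// /xi0.
  by rewrite (min_idPr s0) (max_idPr taus).
- move=> t t0; exists (duhamel S (source u) t); last by rewrite -u_fixed Phi_nonneg.
  apply: eq_is_Rintegral (duhamelP hip Sw (source_continuous cu) t0) => s /andP[s0 _].
  by rewrite /source (max0_id s0).
Qed.

End existence.

(** * Smallness and decay of an arbitrary solution *)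

Section stability.
Context (xi u : R -> H).
Hypothesis sol : delay_mild_solution xi u.

Let cu : continuous (fun t : R => u (Num.max (- tau) t)). Proof. by case: sol. Qed.
Let u_hist s : - tau <= s <= 0 -> u s = xi s. Proof. by case: sol => _ + _; apply. Qed.
Let u_eq (t : R) : 0 <= t -> exists2 I : H,
  is_Rintegral (fun s => S (t - s) (f s (u (s - rho s)))) 0 t I & u t = S t (xi 0) + I.
Proof. by case: sol => _ _; apply. Qed.

(** At a first exit time [t0] from the ball of radius [b], the source on [[0, t0[] sees only earlier
    values, since [s - rho s <= s]. These are at most [b <= r], so the Lipschitz bound applies and
    the norm at [t0] is at most [d + q * b]. *)
Lemma delay_mild_solution_lt (b d : R) : b <= r -> d + q * b < b ->
  (forall s : R, - tau <= s <= 0 -> `|xi s| <= d) -> forall t : R, 0 <= t -> `|u t| < b.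
Proof.
move=> br db xid.
have taut (t : R) : 0 <= t -> Num.max (- tau) t = t.
  by move=> t0; apply/max_idPr; rewrite (le_trans _ t0)// oppr_le0.
have hist0 : - tau <= 0 <= (0 : R) by rewrite oppr_le0 tau_ge0 lexx.
have d0 : 0 <= d by apply: le_trans (xid _ hist0).
have b0 : 0 < b.
  rewrite ltNge; apply/negP => b0; move: db; apply/negP; rewrite -leNgt.
  have : 0 <= (q - 1) * b by rewrite mulr_le0// subr_le0 ltW.
  lra.
have dltb : d < b by apply: le_lt_trans db; rewrite lerDl mulr_ge0// ltW.
pose g (t : R) := b - `|u (Num.max (- tau) t)|.
have cg : continuous g.
  by move=> t; apply: cvgB; [exact: cvg_cst|apply: cvg_norm; exact: cu].
have g0 : 0 < g 0 by rewrite /g taut// u_hist// subr_gt0 (le_lt_trans (xid _ _)).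
move=> t1 t1_ge0; rewrite ltNge; apply/negP => ut1.
have gt1 : g t1 <= 0 by rewrite /g taut// subr_le0.
have [t0 [t0_gt0 gt0 gpos]] := first_nonpos cg g0 t1_ge0 gt1.
have t0_ge0 := ltW t0_gt0.
have [I FI uI] := u_eq t0_ge0.
have ult (s : R) : - tau <= s -> s < t0 -> `|u s| <= b.
  move=> taus st0; have [s0|/ltW s0] := leP s 0.
    by rewrite u_hist ?taus// ltW// (le_lt_trans (xid _ _))// taus.
  by have := gpos s; rewrite s0 st0 /g taut// subr_gt0 => /(_ isT)/ltW.
have Ib : `|I| <= q * b.
  apply: rate_le; apply: (duhamel_bound_uniform Sw t0_ge0 _ FI).
    by rewrite mulr_ge0// ltW.
  move=> s s0 st0; have /andP[lag1 lag2] := lag_bound s0.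
  have ub := ult _ lag1 (le_lt_trans lag2 st0).
  by rewrite (le_trans (f_bound s0 (le_trans ub br)))// ler_wpM2l.
move: gt0; rewrite /g taut// subr_le0 leNgt => /negP; apply.
rewrite uI (le_lt_trans (ler_normD _ _))// (le_lt_trans _ db)// lerD//.
by rewrite (le_trans (evolution_norm1 Sw _ _))// xid.
Qed.

Hypothesis lag_infty : (t - rho t) @[t --> +oo] --> +oo.
Hypothesis u_le : forall t : R, - tau <= t -> `|u t| <= r.

(** Once delayed times exceed [T1], the source contributes at most [q * B]; the rest is a multiple
    of [w (t - T2)] and dies out. Any factor above [q] is thus reached; [(1 + q) / 2] lies halfway
    between [q] and 1. *)
Let decay_step (B T1 : R) : 0 < B -> B <= r -> 0 <= T1 ->
  (forall t : R, T1 <= t -> `|u t| <= B) ->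
  exists2 T' : R, 0 <= T' & forall t : R, T' <= t -> `|u t| <= (1 + q) / 2 * B.
Proof.
move=> B0 Br T1_ge0 uB.
have [T2 T2_ge0 lagT] : exists2 T2 : R, 0 <= T2 & forall s : R, T2 <= s -> T1 <= s - rho s.
  have /cvgryPge /(_ T1) [A [_ AP]] := lag_infty.
  (* Neighbourhoods of [+oo] are given by strict inequalities, hence [A + 1]. *)
  exists (Num.max 0 (A + 1)) => // s; rewrite ge_max => /andP[_ As].
  by apply: AP; apply: lt_le_trans As; rewrite ltrDl.
(* The factor of [w (t - T2)]: [r] from the datum at time 0, the rest from the source before
   [T2]. *)
pose K := r + M * r * (T2 + 1).
have K0 : 0 < K.
  by rewrite /K ltr_wpDr// !mulr_ge0// ?(ltW r_gt0)// addr_ge0.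
have q1 : 0 < 1 - q by rewrite subr_gt0.
(* Solves [K / (L * X) = (1 - q) / 2 * B], where [1 / (L * X)] is the bound on [w] at time [X]. *)
pose X := K / L / ((1 - q) / 2 * B).
have X0 : 0 < X by rewrite /X !divr_gt0// mulr_gt0// divr_gt0.
exists (T2 + X); first by rewrite addr_ge0// ltW.
move=> t tX.
have T2t : T2 <= t by apply: le_trans tX; rewrite lerDl ltW.
have t0 : 0 <= t := le_trans T2_ge0 T2t.
have [I FI uI] := u_eq t0.
have Mr0 : 0 <= M * r by rewrite mulr_ge0// ltW.
have MB0 : 0 <= M * B by rewrite mulr_ge0// ltW.
have F_r s : 0 <= s -> s < t -> `|f s (u (s - rho s))| <= M * B + M * r.
  move=> s0 _; have /andP[lag1 _] := lag_bound s0.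
  rewrite (le_trans (f_bound s0 (u_le lag1)))// (@le_trans _ _ (M * r)) ?lerDr//.
  by rewrite ler_wpM2l// u_le.
have F_B s : T2 <= s -> s < t -> `|f s (u (s - rho s))| <= M * B.
  move=> T2s _; have s0 := le_trans T2_ge0 T2s.
  have /andP[lag1 _] := lag_bound s0.
  by rewrite (le_trans (f_bound s0 (u_le lag1)))// ler_wpM2l// uB// lagT.
have Ib := duhamel_bound Sw T2_ge0 T2t MB0 Mr0 FI F_r F_B.
have {}Ib : `|I| <= q * B + M * r * (T2 + 1) * w (t - T2).
  rewrite -(ler_pM2l L_gt0) mulrDr (le_trans Ib)// lerD2r /q.
  by rewrite mulrA mulrCA mulfV ?mulr1 ?gt_eqF// mulrC.
have y_gt0 : 0 < t - T2 by rewrite subr_gt0 (lt_le_trans _ tX)// ltrDl.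
have wy : K * w (t - T2) <= (1 - q) / 2 * B.
  have wd := weight_decay Sw (ltW y_gt0).
  have e0 : 0 < (1 - q) / 2 * B by rewrite mulr_gt0// divr_gt0.
  have Xy : K / L <= (t - T2) * ((1 - q) / 2 * B).
    by rewrite -ler_pdivrMr// -/X lerBrDl.
  have wy0 := weight_ge0 Sw (ltW y_gt0).
  have : K * w (t - T2) <= L * w (t - T2) * ((t - T2) * ((1 - q) / 2 * B)).
    have -> : K * w (t - T2) = L * w (t - T2) * (K / L) by field; rewrite gt_eqF.
    by rewrite ler_wpM2l// mulr_ge0// ltW.
  move=> /le_trans; apply.
  have -> : L * w (t - T2) * ((t - T2) * ((1 - q) / 2 * B)) =
    (L * ((t - T2) * w (t - T2))) * ((1 - q) / 2 * B) by ring.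
  by rewrite ler_piMl// ltW.
rewrite uI (le_trans (ler_normD _ _))//.
have hist0 : - tau <= 0 <= (0 : R) by rewrite oppr_le0 tau_ge0 lexx.
have S_le : `|S t (xi 0)| <= w (t - T2) * r.
  rewrite (le_trans (evolution_norm Sw _ t0))// ler_pM// ?(weight_ge0 Sw)//.
    by rewrite (weight_nonincreasing Sw) ?subr_ge0// gerBl.
  by rewrite -u_hist// u_le// oppr_le0.
have -> : (1 + q) / 2 * B = (1 - q) / 2 * B + q * B by field.
have : K * w (t - T2) = w (t - T2) * r + M * r * (T2 + 1) * w (t - T2).
  by rewrite /K; ring.
lra.
Qed.

Lemma delay_mild_solution_cvg0 : `|u t| @[t --> +oo] --> (0 : R).
Proof.
pose q' := (1 + q) / 2.
have q'0 : 0 < q' by rewrite divr_gt0// ltr_wpDr.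
have q'1 : q' < 1 by rewrite ltr_pdivrMr// mul1r ltrD2l.
have iterated n : exists2 T' : R, 0 <= T' &
    forall t : R, T' <= t -> `|u t| <= r * q' ^+ n.
  elim: n => [|n [T1 T10 uT1]].
    by exists 0 => // t t0; rewrite expr0 mulr1 u_le// (le_trans _ t0)// oppr_le0.
  have qn1 : q' ^+ n <= 1 by rewrite exprn_ile1// ltW.
  have B0 : 0 < r * q' ^+ n by rewrite mulr_gt0// exprn_gt0.
  have Br : r * q' ^+ n <= r by rewrite ler_piMr// ltW.
  have [T' T'0 uT'] := decay_step B0 Br T10 uT1.
  by exists T' => // t /uT'; rewrite exprS mulrCA.
apply/cvgrPdist_le => e e0.
have [n ne] := geometric_small r (ltW q'0) q'1 e0.
have [T' T'0 uT'] := iterated n.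
exists T'; split; first exact: num_real.
move=> t /ltW T't; rewrite sub0r normrN normr_id.
exact: le_trans (uT' _ T't) ne.
Qed.

End stability.

End delay_equation.

(** * Diagonal operators *)

Section diagonal_operators.
Context {R : realType} {H : normedModType R} (ip : H -> H -> R).
Hypothesis hip : hilbert_inner_product ip.
Context (phi : nat -> H).
Hypothesis phi_orthonormal : forall i j, ip (phi i) (phi j) = (i == j)%:R.

Let coef v i := ip v (phi i).

Definition diagonal_sum (b : nat -> R) (v : H) (N : nat) : H :=
  \sum_(n < N) (b n * coef v n) *: phi n.

Definition diagonal_operator (b : nat -> R) (v : H) : H := limn (diagonal_sum b v).

Lemma norm_orthonormal_sum (a : nat -> R) m n :
  `|\sum_(m <= i < n) a i *: phi i| ^+ 2 = \sum_(m <= i < n) a i ^+ 2.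
Proof.
have ipphi j k : ip (\sum_(m <= i < k) a i *: phi i) (phi j) =
    \sum_(m <= i < k) a i * (i == j)%:R.
  rewrite (big_morph (ip^~ (phi j)) (fun x y => hip_addl hip x y _) (ip0l hip _)).
  by apply: eq_bigr => i _; rewrite (hip_scalel hip) phi_orthonormal.
have [nm|mn] := leqP n m; first by rewrite !big_geq// normr0 expr0n.
elim: n mn => // n IH; rewrite ltnS leq_eqVlt => /predU1P[->|mn].
  rewrite !big_nat1 -(hip_norm hip) (hip_scalel hip) ipZr// phi_orthonormal eqxx.
  by rewrite mulr1 expr2.
rewrite !big_nat_recr ?(ltnW mn)//= -IH// -!(hip_norm hip).
set x := \sum_(m <= i < n) _.
have xn : ip x (phi n) = 0.
  rewrite /x ipphi big_nat_cond big1// => i /andP[/andP[_ iltn] _].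
  by rewrite ltn_eqF// mulr0.
rewrite !(hip_addl hip) (hip_sym hip x) (hip_sym hip (a n *: _) (x + _)) !(hip_addl hip).
rewrite !(hip_scalel hip) !(ipZr hip) (hip_sym hip (phi n) x) xn phi_orthonormal eqxx.
by rewrite !mulr0 !addr0 ?add0r mulr1 expr2.
Qed.

Let diagonal_sumE b v m n : (m <= n)%N ->
  diagonal_sum b v n - diagonal_sum b v m = \sum_(m <= i < n) (b i * coef v i) *: phi i.
Proof.
move=> mn; rewrite /diagonal_sum -!(big_mkord xpredT (fun i => (b i * coef v i) *: phi i)).
by rewrite (big_cat_nat (leq0n m) mn)/= addrAC subrr add0r.
Qed.

Let one_sum v N := diagonal_sum (fun=> 1) v N.

Let one_sum_dist v N : `|v - one_sum v N| ^+ 2 = `|v| ^+ 2 - \sum_(0 <= i < N) coef v i ^+ 2.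
Proof.
have E : one_sum v N = \sum_(0 <= i < N) coef v i *: phi i.
  by rewrite big_mkord; apply: eq_bigr => i _; rewrite mul1r.
have cross : ip v (one_sum v N) = \sum_(0 <= i < N) coef v i ^+ 2.
  rewrite (hip_sym hip) E.
  rewrite (big_morph (ip^~ v) (fun x y => hip_addl hip x y _) (ip0l hip _)).
  by apply: eq_bigr => i _; rewrite (hip_scalel hip) (hip_sym hip) expr2.
rewrite -(hip_norm hip) (ipBl hip) !(ipBr hip) (hip_sym hip (one_sum v N) v) cross.
by rewrite !(hip_norm hip) [in `|one_sum v N|]E norm_orthonormal_sum subrr subr0.
Qed.

Lemma bessel v N : \sum_(0 <= i < N) coef v i ^+ 2 <= `|v| ^+ 2.
Proof. by rewrite -subr_ge0 -one_sum_dist sqr_ge0. Qed.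

Let coef_tail v (e : R) : 0 < e ->
  exists N, forall m n, (N <= m)%N -> (m <= n)%N -> \sum_(m <= i < n) coef v i ^+ 2 <= e.
Proof.
move=> e0; pose s n := \sum_(0 <= i < n) coef v i ^+ 2.
have s_nd : nondecreasing_seq s.
  by apply/nondecreasing_seqP => n; rewrite /s big_nat_recr//= lerDl sqr_ge0.
have s_ub : has_ubound (range s).
  by exists (`|v| ^+ 2) => _ [n _ <-]; exact: bessel.
have sc := nondecreasing_cvgn s_nd s_ub.
have /cvgrPdist_le /(_ _ e0) [N _ NP] := sc.
exists N => m n Nm mn.
have -> : \sum_(m <= i < n) coef v i ^+ 2 = s n - s m.
  by rewrite /s (big_cat_nat (leq0n m) mn)/= addrAC subrr add0r.
have sn : s n <= sup (range s).
  by apply: ub_le_sup => //; exists n.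
have := NP _ Nm; rewrite ger0_norm; first by lra.
by rewrite subr_ge0; apply: ub_le_sup => //; exists m.
Qed.

Let diagonal_sum_le b v (B : R) m n : 0 <= B -> (forall i, `|b i| <= B) ->
  `|\sum_(m <= i < n) (b i * coef v i) *: phi i| ^+ 2 <=
  B ^+ 2 * \sum_(m <= i < n) coef v i ^+ 2.
Proof.
move=> B0 bB; rewrite norm_orthonormal_sum mulr_sumr; apply: ler_sum => i _.
rewrite exprMn ler_wpM2r ?sqr_ge0// -(real_normK (num_real (b i))).
by rewrite lerXn2r ?nnegrE.
Qed.

(** [N] is chosen before the multipliers [b]: this uniformity makes time-dependent diagonal
    operators uniform limits of finite sums, hence continuous in time. *)
Let diagonal_sum_tail v (e : R) : 0 < e -> exists N, forall b, (forall i, `|b i| <= 1) ->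
  forall m n, (N <= m)%N -> (m <= n)%N ->
  `|diagonal_sum b v n - diagonal_sum b v m| <= e.
Proof.
move=> e0; have e20 : 0 < e ^+ 2 by rewrite exprn_gt0.
have [N NP] := coef_tail v e20; exists N => b b1 m n Nm mn.
rewrite diagonal_sumE// -(@ler_pXn2r _ 2)// ?nnegrE ?(ltW e0)//.
apply: (le_trans (diagonal_sum_le v m n ler01 b1)).
by rewrite expr1n mul1r; exact: NP.
Qed.

Lemma diagonal_operator_cvg b v : (forall i, `|b i| <= 1) ->
  diagonal_sum b v @ \oo --> diagonal_operator b v.
Proof.
move=> b1; have [l bl] : exists l : H, diagonal_sum b v @ \oo --> l.
  apply: (hip_complete hip) => e e0.
  have [N NP] := diagonal_sum_tail v e0; exists N => m n Nm Nn.
  have [mn|/ltnW nm] := leqP m n; last exact: NP.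
  by rewrite distrC; exact: NP.
by rewrite /diagonal_operator; apply: cvgP bl.
Qed.

Lemma diagonal_operator_norm b v (B : R) : 0 <= B -> B <= 1 -> (forall i, `|b i| <= B) ->
  `|diagonal_operator b v| <= B * `|v|.
Proof.
move=> B0 B1 bB.
have b1 i : `|b i| <= 1 := le_trans (bB i) B1.
apply: (cvg_norm_le (@diagonal_operator_cvg b v b1)); apply: nearW => n.
rewrite -(@ler_pXn2r _ 2)// ?nnegrE ?mulr_ge0//.
have -> : diagonal_sum b v n = \sum_(0 <= i < n) (b i * coef v i) *: phi i.
  by rewrite big_mkord.
apply: (le_trans (diagonal_sum_le v 0 n B0 bB)).
by rewrite exprMn ler_wpM2l ?sqr_ge0// bessel.
Qed.

Lemma diagonal_operatorB b u v : (forall i, `|b i| <= 1) ->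
  diagonal_operator b (u - v) = diagonal_operator b u - diagonal_operator b v.
Proof.
move=> b1; apply/cvg_lim => //.
rewrite (_ : diagonal_sum b (u - v) = (fun n => diagonal_sum b u n - diagonal_sum b v n)).
  by apply: cvgB; exact: diagonal_operator_cvg.
apply/funext => n; rewrite /diagonal_sum -sumrB; apply: eq_bigr => i _.
by rewrite /coef (ipBl hip) mulrBr scalerBl.
Qed.

Lemma diagonal_operator_continuous (b : R -> nat -> R) v :
  (forall t i, `|b t i| <= 1) -> (forall i, continuous (b^~ i)) ->
  continuous (fun t => diagonal_operator (b t) v).
Proof.
move=> b1 cb t; apply/cvgrPdist_lt => e e0.
have e30 : 0 < e / 3 by rewrite divr_gt0.
have [N NP] := diagonal_sum_tail v e30.
have dist s : `|diagonal_operator (b s) v - diagonal_sum (b s) v N| <= e / 3.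
  apply: (@cvg_norm_le _ _ (fun n => diagonal_sum (b s) v n - diagonal_sum (b s) v N)).
    by apply: cvgB; [exact: diagonal_operator_cvg|exact: cvg_cst].
  by exists N => // n /= Nn; exact: NP.
have csum : continuous (fun s => diagonal_sum (b s) v N).
  apply: (@continuous_sum _ _ _ N (fun i s => (b s i * coef v i) *: phi i)) => i s.
  apply: cvgZr_tmp; apply: cvgM; [exact: cb|exact: cvg_cst].
have /cvgrPdist_lt /(_ _ e30) := csum t.
apply: filterS => s ts.
have -> : e = e / 3 + (e / 3 + e / 3) by field.
rewrite (le_lt_trans (ler_distD (diagonal_sum (b t) v N) _ _))// ler_ltD//.
rewrite (le_lt_trans (ler_distD (diagonal_sum (b s) v N) _ _))// ltr_leD//.
by rewrite distrC.
Qed.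

Hypothesis phi_dense : dense [set v | exists n (a : nat -> R), v = \sum_(i < n) a i *: phi i].

(** The remainder [v - one_sum v N] has norm at most that of [v], and it vanishes on a finite
    combination of the basis for large [N]; density then suffices. *)
Lemma diagonal_operator_id b v : (forall i, b i = 1) -> diagonal_operator b v = v.
Proof.
move=> b1; have {b1}-> : b = fun=> 1 by apply/funext.
apply/cvg_lim => //; apply/cvgrPdist_le => e e0.
have [w [vw [n [a wE]]]] : (ball v e)° `&`
    [set v | exists n (a : nat -> R), v = \sum_(i < n) a i *: phi i] !=set0.
  apply: phi_dense; last exact: open_interior.
  by exists v; exact: nbhsx_ballx.
have {}vw : `|v - w| < e.
  by have := interior_subset vw; rewrite -ball_normE.
exists n => // N /= nN.
have wN : one_sum w N = w.
  rewrite /one_sum /diagonal_sum.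
  have cw i : coef w i = if (i < n)%N then a i else 0.
    rewrite /coef wE (ip_suml hip).
    under eq_bigr do rewrite (hip_scalel hip) phi_orthonormal.
    case: ifPn => [iltn|]; last first.
      by rewrite -leqNgt => ni; rewrite big1// => j _; rewrite ltn_eqF ?mulr0// (leq_trans _ ni).
    rewrite (bigD1 (Ordinal iltn))//= eqxx mulr1 big1 ?addr0// => j ji.
    by rewrite (_ : (_ == _) = false) ?mulr0//; apply/negbTE.
  under eq_bigr do rewrite mul1r cw.
  rewrite -(big_mkord xpredT (fun i => (if (i < n)%N then a i else 0) *: phi i)).
  rewrite (big_cat_nat (leq0n n) nN)/= [X in _ + X]big_nat_cond [X in _ + X]big1 ?addr0; last first.
    by move=> i /andP[/andP[ni _] _]; rewrite ltnNge ni scale0r.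
  by rewrite big_mkord [RHS]wE; apply: eq_bigr => i _; rewrite ltn_ord.
have -> : v - one_sum v N = (v - w) - one_sum (v - w) N.
  have -> : one_sum (v - w) N = one_sum v N - one_sum w N.
    rewrite /one_sum /diagonal_sum -sumrB; apply: eq_bigr => i _.
    by rewrite /coef (ipBl hip) mulrBr scalerBl.
  by rewrite wN opprB addrA subrK.
apply: le_trans (ltW vw).
rewrite -(@ler_pXn2r _ 2)// ?nnegrE// one_sum_dist gerBl.
by apply: sumr_ge0 => i _; exact: sqr_ge0.
Qed.

End diagonal_operators.

(** * Asymptotic stability *)

Section retraction.
Context {X Y : topologicalType}.

(** With the converse below, this links continuity on half-lines and intervals to the total
    functions of the abstract argument, through retractions such as [Num.max 0]. *)
Lemma continuous_within_retract (A : set X) (pr : X -> X) (g : X -> Y) :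
  continuous pr -> (forall x, A (pr x)) -> {within A, continuous g} ->
  continuous (fun x => g (pr x)).
Proof.
move=> cpr Apr /subspace_continuousP cg x U /(cg _ (Apr x)) gU.
have {}gU : nbhs (pr x) [set y | A y -> U (g y)] by exact: gU.
by apply: (@filterS _ (nbhs x) _ _ _ _ (cpr x _ gU)) => y /= h; exact: h.
Qed.

Lemma continuous_retract_within (A : set X) (pr : X -> X) (g : X -> Y) :
  (forall x, A x -> pr x = x) -> continuous (fun x => g (pr x)) -> {within A, continuous g}.
Proof.
move=> prA cg; apply: (@subspace_eq_continuous _ A Y (g \o pr)).
  by move=> x /[!inE] Ax /=; rewrite prA.
exact: continuous_subspaceT.
Qed.

End retraction.

Section essential_bound.
Context {R : realType}.
Implicit Types (p kappa : R -> R).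

Lemma Linfty_norm_fineK p : in_Linfty p -> (fine (Linfty_norm p))%:E = Linfty_norm p.
Proof.
by move=> [_ fin]; rewrite fineK// ge0_fin_numE// /Linfty_norm Lnorm_ge0.
Qed.

Lemma fine_Linfty_norm_ge0 p : 0 <= fine (Linfty_norm p).
Proof. by rewrite fine_ge0// /Linfty_norm Lnorm_ge0. Qed.

Lemma halfline_measure_itv (t e : R) : 0 <= t -> 0 < e ->
  halfline_measure R `]t, t + e[%classic = e%:E.
Proof.
move=> t0 e0; rewrite /halfline_measure/= /mrestr.
rewrite (_ : _ `&` _ = `]t, t + e[%classic).
  by rewrite lebesgue_measure_itv/= lte_fin ltrDl e0 -EFinD addrC addKr.
apply/setIidPl => s; rewrite /= !in_itv/= => /andP[ts _].
by rewrite andbT (le_trans t0)// ltW.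
Qed.

(** An interval of positive length cannot lie in the null set where the essential bound fails. *)
Lemma Linfty_norm_dense_bound p (t e : R) : in_Linfty p -> 0 <= t -> 0 < e ->
  exists2 s, t < s < t + e & p s <= fine (Linfty_norm p).
Proof.
move=> hp t0 e0.
(* The norm of exponent [+oo] unfolds to an essential supremum only for a nonzero measure. *)
have mu0 : (0 < halfline_measure R [set: measurableTypeR R])%E.
  apply: (@lt_le_trans _ _ (halfline_measure R `]0%R, (0 + 1)%R[%classic)).
    by rewrite halfline_measure_itv.
  by apply: le_measure; rewrite ?inE.
have [N [mN N0 subN]] : {ae halfline_measure R, forall s, p s <= fine (Linfty_norm p)}.
  have := ess_sup_ge (halfline_measure R) (abse \o (EFin \o p)).
  apply: filterS => s /=.
  rewrite -lee_fin Linfty_norm_fineK// /Linfty_norm unlock mu0.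
  by apply: le_trans; rewrite lee_fin ler_norm.
apply: contrapT => nex.
have sub : `]t, t + e[ `<=` N.
  move=> s; rewrite /= in_itv/= => ts; apply: subN => /= ps.
  by apply: nex; exists s.
have : (halfline_measure R `]t, (t + e)%R[%classic <= halfline_measure R N)%E.
  by apply: le_measure; rewrite ?inE.
by rewrite N0 halfline_measure_itv// lee_fin leNgt e0.
Qed.

(** Otherwise [kappa] is at least [l / P] at every positive radius, and so is its supremum on every
    right neighbourhood of 0. The degenerate case [P = 0] contradicts [0 < l] directly. *)
Lemma limf_esup_right_lt p kappa (l : R) : in_Linfty p -> 0 < l ->
  (Linfty_norm p * limf_esup (EFin \o kappa) 0^'+ < l%:E)%E ->
  exists2 r, 0 < r & fine (Linfty_norm p) * kappa r < l.
Proof.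
move=> hp l0; rewrite -Linfty_norm_fineK//; set P := fine _ => Pl.
have P0 : 0 <= P := fine_Linfty_norm_ge0 p.
apply: contrapT => nex.
have lP r : 0 < r -> l <= P * kappa r.
  by move=> r0; rewrite leNgt; apply/negP => ?; apply: nex; exists r.
have P_gt0 : 0 < P.
  rewrite lt_neqAle P0 andbT; apply/eqP => P00.
  by have := lP 1 ltr01; rewrite -P00 mul0r leNgt l0.
move: Pl; apply/negP; rewrite -leNgt.
have -> : (l%:E = P%:E * (l / P)%:E)%E by rewrite -EFinM mulrC divfK// gt_eqF.
rewrite lee_pmul2l ?lte_fin//.
apply: le_ereal_inf_tmp => _ [V VF <-].
have [x [Vx x0]] : exists x, V x /\ 0 < x.
  have /filter_ex[x [Vx x0]] : \forall x \near (0 : R)^'+, V x /\ 0 < x.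
    by apply: filterI; [exact: VF|exact: nbhs_right_gt].
  by exists x.
apply: (@le_trans _ _ (kappa x)%:E).
  by rewrite lee_fin ler_pdivrMr// mulrC; exact: lP.
by apply: ereal_sup_ubound; exists x.
Qed.

End essential_bound.

Section resolvent_family.
Context {R : realType} (d : nat) (Omega : smooth_domain R d).

Lemma L2_hilbert : @hilbert_inner_product R (L2 Omega) (@L2inner _ _ R (lebesgue_on Omega)).
Proof.
split.
- exact: L2innerDl.
- exact: L2innerZl.
- exact: L2innerC.
- exact: L2innerE.
- exact: L2space_cauchy_cvg.
Qed.

Context (gamma alpha : R) (omega : R -> R -> R) (lam : nat -> R) (phi : nat -> L2 Omega).
Hypothesis gamma_gt0 : 0 < gamma.
Hypothesis alpha_itv : 0 < alpha < 1.
Hypothesis homega : relaxation_function gamma alpha omega.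
Hypothesis hphi : dirichlet_eigenbasis lam phi.

(* If the integral defining Gamma were infinite its real value would be 0, hence so
   would c, by x / 0 = 0: finiteness of Gamma need not be proved. *)
Let c := gamma / Gamma (1 - alpha).

Let c_ge0 : 0 <= c.
Proof.
rewrite divr_ge0 ?(ltW gamma_gt0)//; apply: Rintegral_ge0 => x _.
by rewrite mulr_ge0 ?powR_ge0 ?expR_ge0.
Qed.

Let beta_itv : 0 < 1 - alpha < 1.
Proof. by move: alpha_itv => /andP[? ?]; apply/andP; split; lra. Qed.

Let omega_rel (m : R) : 0 < m ->
  volterra_relaxation (power_kernel c (1 - alpha)) m (fun t => omega (Num.max 0 t) m).
Proof.
move=> m0; have [cw eqw] := homega m0; split.
  have halfline (t : R) : `[0, +oo[%classic (Num.max 0 t).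
    by rewrite /= in_itv/= andbT le_max lexx.
  exact: (continuous_within_retract continuous_max0 halfline cw).
move=> t t0; rewrite (max_idPr t0) -[RHS](eqw t t0); congr (_ + _ * _).
apply: eq_Rintegral => s; rewrite inE/= in_itv/= => /andP[s0 st].
rewrite (max_idPr s0); congr (_ * _); rewrite /power_kernel /gker /c; congr (_ + _).
by rewrite [in RHS]mulrA mulrAC.
Qed.

Let km := measurable_power_kernel c (1 - alpha).
Let k1 := power_kernel_ge1 (1 - alpha) c_ge0.
Let kle := power_kernel_le c_ge0 beta_itv.
Let klc := power_kernel_logconvex c_ge0 beta_itv.
Let kint := @integrable_power_kernel R c (1 - alpha) beta_itv.

Let max0_id (t : R) : 0 <= t -> Num.max 0 t = t. Proof. by move=> /max_idPr. Qed.
Let max0_ge0 (t : R) : 0 <= Num.max 0 t. Proof. by rewrite le_max lexx. Qed.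

Let lam0 : 0 < lam 0%N. Proof. by case: hphi. Qed.
Let lam_le n : lam 0%N <= lam n. Proof. by case: hphi => _ _ + _ _; apply. Qed.
Let lam_gt0 n : 0 < lam n. Proof. exact: lt_le_trans (lam_le n). Qed.

Let omega_gt0 (t : R) n : 0 <= t -> 0 < omega t (lam n).
Proof.
move=> t0; have := relaxation_gt0 k1 kle kint (lam_gt0 n) (omega_rel (lam_gt0 n)) t0.
by rewrite (max0_id t0).
Qed.

Let omega_le1 (t : R) n : 0 <= t -> omega t (lam n) <= 1.
Proof.
move=> t0; have := relaxation_le1 k1 kle kint (lam_gt0 n) (omega_rel (lam_gt0 n)) t0.
by rewrite (max0_id t0).
Qed.

Let omega_norm_le1 (t : R) n : 0 <= t -> `|omega t (lam n)| <= 1.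
Proof. by move=> t0; rewrite ger0_norm ?omega_le1// ltW// omega_gt0. Qed.

(** The first mode decays slowest, so a single scalar function dominates all multipliers of the
    resolvent. *)
Let omega_le_first (t : R) n : 0 <= t -> omega t (lam n) <= omega t (lam 0%N).
Proof.
move=> t0.
have := relaxation_param_le km k1 kle klc kint lam0 (lam_le n)
  (omega_rel lam0) (omega_rel (lam_gt0 n)) t0.
by rewrite (max0_id t0).
Qed.

Let orthonormal i j : @L2inner _ _ R (lebesgue_on Omega) (phi i) (phi j) = (i == j)%:R.
Proof. by case: hphi => -[]. Qed.

Let resolventE t v : resolvent omega lam phi t v =
  diagonal_operator (@L2inner _ _ R (lebesgue_on Omega)) phi (fun n => omega t (lam n)) v.
Proof. by []. Qed.

Lemma resolvent_evolution_family :
  evolution_family (resolvent omega lam phi) (omega ^~ (lam 0%N)) (lam 0%N).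
Proof.
have rel0 := omega_rel lam0.
split.
- move=> t u v t0; rewrite !resolventE.
  by apply: (diagonal_operatorB L2_hilbert orthonormal) => i; exact: omega_norm_le1.
- move=> v; rewrite resolventE; apply: (diagonal_operator_id L2_hilbert orthonormal).
    by case: hphi => -[].
  by move=> i; have := relaxation0 (omega_rel (lam_gt0 i)); rewrite maxxx.
- move=> t v t0; rewrite resolventE.
  apply: (diagonal_operator_norm L2_hilbert orthonormal).
  + by rewrite ltW// omega_gt0.
  + exact: omega_le1.
  + by move=> i; rewrite ger0_norm ?omega_le_first// ltW// omega_gt0.
- move=> v; apply: (diagonal_operator_continuous L2_hilbert orthonormal
    (b := fun t i => omega (Num.max 0 t) (lam i))) => [t i|i].
    exact: omega_norm_le1.
  exact: (omega_rel (lam_gt0 i)).1.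
- by move=> t t0; rewrite ltW// omega_gt0.
- by move=> t t0; exact: omega_le1.
- move=> s t s0 st.
  have := relaxation_nonincreasing km k1 kle klc kint lam0 rel0 s0 st.
  by rewrite !max0_id// (le_trans s0).
- exact: lam0.
- move=> t t0; have := relaxation_decay km k1 kle klc kint lam0 rel0 t0.
  by rewrite max0_id.
- move=> t n x x0 xn xle.
  have := relaxation_left_sum km k1 kle klc kint lam0 rel0 x0 xn xle.
  have xmono j : (j <= n)%N -> x j <= x n.
    move=> jn; rewrite -(subnKC jn).
    have : (j + (n - j) <= n)%N by rewrite subnKC.
    elim: (n - j)%N => [|i IH]; first by rewrite addn0.
    by rewrite addnS => jin; apply: le_trans (xle _ jin); apply: IH; exact: ltnW.
  congr (lam 0%N * _ <= 1); apply: eq_bigr => i _.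
  by rewrite max0_id// subr_ge0 -xn xmono// ltnW.
Qed.

End resolvent_family.

(** A real supremum bounds its set only when the set is bounded above, which compactness of the
    history interval provides. *)
Lemma history_norm_ge (R : realType) d (Omega : smooth_domain R d) (tau : R)
    (xi : R -> L2 Omega) s :
  {within `[- tau, 0], continuous xi} -> - tau <= s <= 0 -> `|xi s| <= history_norm tau xi.
Proof.
move=> cxi sI; apply: ub_le_sup; last by exists s => //=; rewrite in_itv.
have /compact_bounded[M [_ MP]] := continuous_compact cxi (@segment_compact R (- tau) 0).
exists (M + 1) => _ [t tI <-].
by apply: (MP (M + 1)); [rewrite ltrDl|exists t].
Qed.

Theorem theorem3p5 (R : realType) (d : nat) (Omega : smooth_domain R d)
    (gamma alpha tau : R) (rho : R -> R) (omega : R -> R -> R)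
    (lam : nat -> R) (phi : nat -> L2 Omega)
    (f : R -> L2 Omega -> L2 Omega) (p kappa : R -> R)
    (hgamma : 0 < gamma) (halpha : 0 < alpha < 1) (htau : 0 <= tau)
    (hrho_cont : {within `[0, +oo[, continuous rho})
    (hrho_bound : forall t, 0 <= t -> - tau <= t - rho t <= t)
    (hrho_lim : (t - rho t) @[t --> +oo] --> +oo)
    (homega : relaxation_function gamma alpha omega)
    (hphi : dirichlet_eigenbasis lam phi)
    (hf_cont : {within [set x : R * L2 Omega | 0 <= x.1],
                  continuous (fun x : R * L2 Omega => f x.1 x.2)})
    (hf0 : forall t, 0 <= t -> f t 0 = 0)
    (hf_lip : forall r, 0 <= r -> forall t, 0 <= t -> forall v1 v2 : L2 Omega,
       `|v1| <= r -> `|v2| <= r ->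
       `|f t v1 - f t v2| <= p t * kappa r * `|v1 - v2|)
    (hp : in_Linfty p) (hp_ge0 : forall t, 0 <= t -> 0 <= p t)
    (hkappa_cont : {within `[0, +oo[, continuous kappa})
    (hkappa_lim :
       (Linfty_norm p * limf_esup (EFin \o kappa) 0^'+ < (lam 0%N)%:E)%E) :
  zero_asymptotically_stable omega lam phi tau rho f.
Proof.
have lam0 : 0 < lam 0%N by case: hphi.
have Sw := resolvent_evolution_family hgamma halpha homega hphi.
have hip := L2_hilbert Omega.
have [r r0 rP] := limf_esup_right_lt hp lam0 hkappa_lim.
set P := fine (Linfty_norm p) in rP.
(* [kappa r] may be negative, whereas the contraction argument takes a nonnegative constant. *)
pose M := Num.max 0 (P * kappa r).
have M0 : 0 <= M by rewrite le_max lexx.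
have MlamP : M < lam 0%N by rewrite gt_max lam0.
have max0_ge0 (t : R) : 0 <= Num.max 0 t by rewrite le_max lexx.
have cf : continuous (fun x : R * L2 Omega => f (Num.max 0 x.1) x.2).
  have cpr : continuous (fun x : R * L2 Omega => (Num.max 0 x.1, x.2)).
    apply: continuous_pair => x; last exact: cvg_snd.
    by apply: (@continuous_comp _ _ _ fst (fun t : R => Num.max 0 t));
      [exact: cvg_fst|exact: continuous_max0].
  exact: (continuous_within_retract cpr (fun x => max0_ge0 x.1) hf_cont).
have clag : continuous (fun s : R => Num.max 0 s - rho (Num.max 0 s)).
  have crho : continuous (fun t : R => rho (Num.max 0 t)).
    apply: (continuous_within_retract continuous_max0 _ hrho_cont) => t.
    by rewrite /= in_itv/= andbT.
  by move=> s; apply: cvgB; [exact: continuous_max0|exact: crho].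
(* A strict violation at [t] persists at nearby times by continuity of [f], in particular at some
   [s > t] with [p s <= P], where [hf_lip] excludes it. *)
have flip (t : R) v1 v2 : 0 <= t -> `|v1| <= r -> `|v2| <= r ->
    `|f t v1 - f t v2| <= M * `|v1 - v2|.
  move=> t0 v1r v2r; rewrite leNgt; apply/negP => lt_f.
  have cdiff : continuous (fun s : R => `|f (Num.max 0 s) v1 - f (Num.max 0 s) v2|).
    have cfv v : continuous (fun s : R => f (Num.max 0 s) v).
      move=> s; apply: (@continuous_comp _ _ _ (fun s : R => (s, v))
        (fun x : R * L2 Omega => f (Num.max 0 x.1) x.2)); last exact: cf.
      by apply: continuous_pair => y; [exact: cvg_id|exact: cvg_cst].
    by move=> s; apply: cvg_norm; apply: cvgB; exact: cfv.
  have : \forall s \near t, M * `|v1 - v2| < `|f (Num.max 0 s) v1 - f (Num.max 0 s) v2|.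
    have := cdiff t => /cvgr_gt; apply.
    by rewrite (max_idPr t0).
  move=> /nbhs_ballP[e /= e0 eP].
  have [s /andP[ts se] ps] := Linfty_norm_dense_bound hp t0 e0.
  have s0 : 0 <= s by rewrite (le_trans t0)// ltW.
  have := eP s; rewrite (max_idPr s0) /ball/= => /(_ _).
  have -> : `|t - s| < e by rewrite distrC gtr0_norm ?subr_gt0// ltrBlDl.
  move=> /(_ isT); apply/negP; rewrite -leNgt.
  apply: (le_trans (hf_lip _ (ltW r0) _ s0 _ _ v1r v2r)).
  rewrite ler_wpM2r//; have [k0|/ltW k0] := leP 0 (kappa r).
    by rewrite le_max; apply/orP; right; rewrite ler_wpM2r.
  by rewrite le_max mulr_ge0_le0// hp_ge0.
pose q := M / lam 0%N.
have q1 : q < 1 by rewrite ltr_pdivrMr// mul1r.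
have pr_cont : continuous (fun t : R => Num.max (- tau) t).
  move=> t; apply: (@continuous_max R R^o (fun=> - tau) (fun t => t) t); first exact: cvg_cst.
  exact: cvg_id.
have to_delay xi u : mild_solution omega lam phi tau rho f xi u ->
    delay_mild_solution (resolvent omega lam phi) tau rho f xi u.
  move=> [cu uxi ueq]; split => //.
  apply: (continuous_within_retract pr_cont _ cu) => t.
  by rewrite /= in_itv/= andbT le_max lexx.
have of_delay xi u : delay_mild_solution (resolvent omega lam phi) tau rho f xi u ->
    mild_solution omega lam phi tau rho f xi u.
  move=> [cu uxi ueq]; split => //.
  apply: (@continuous_retract_within _ _ `[- tau, +oo[ _ u _ cu) => t.
  by rewrite /= in_itv/= andbT => /max_idPr.
have small_lt (xi u : R -> L2 Omega) b : 0 < b -> b <= r ->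
    {within `[- tau, 0], continuous xi} -> history_norm tau xi <= (1 - q) * b / 2 ->
    mild_solution omega lam phi tau rho f xi u -> forall t, 0 <= t -> `|u t| < b.
  move=> b0 br cxi hxi /to_delay sol.
  (* Halving [(1 - q) * b] leaves the strict margin that the first-exit argument requires. *)
  have db : (1 - q) * b / 2 + q * b < b by nra.
  have xid (s : R) : - tau <= s <= 0 -> `|xi s| <= (1 - q) * b / 2.
    by move=> sI; apply: le_trans hxi; exact: history_norm_ge.
  exact: (delay_mild_solution_lt Sw htau hrho_bound r0 M0 MlamP hf0 flip sol br db xid).
have small_gt0 b : 0 < b -> 0 < (1 - q) * b / 2.
  by move=> b0; rewrite divr_gt0// mulr_gt0// subr_gt0.
exists ((1 - q) * r / 2); first exact: small_gt0.
split=> [xi cxi hxi|eps eps0].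
  have xi_le (s : R) : - tau <= s <= 0 -> `|xi s| <= (1 - q) * r / 2.
    by move=> sI; apply: le_trans hxi; exact: history_norm_ge.
  have := small_gt0 _ r0 => d0.
  split.
    have cxi0 : continuous (fun t : R => xi (Num.max (- tau) (Num.min 0 t))).
      have cpr : continuous (fun t : R => Num.max (- tau) (Num.min 0 t)).
        move=> t; apply: (@continuous_comp _ _ _ (fun t : R => Num.min 0 t)
          (fun t : R => Num.max (- tau) t)); last exact: pr_cont.
        apply: (@continuous_min R R^o (fun=> 0) (fun t => t) t); first exact: cvg_cst.
        exact: cvg_id.
      apply: (continuous_within_retract cpr _ cxi) => t.
      rewrite /= in_itv/= le_max lexx /= ge_max oppr_le0 htau /=.
      by rewrite ge_min lexx.
    have xi_le' (s : R) : - tau <= s <= 0 -> `|xi s| <= (1 - q) * r.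
      by move=> /xi_le /le_trans; apply; lra.
    have [u solu] := delay_mild_solution_exists hip Sw htau cf clag r0 M0 MlamP hf0 flip
      cxi0 xi_le'.
    by exists u; exact: of_delay.
  move=> u sol.
  have u_le (t : R) : - tau <= t -> `|u t| <= r.
    move=> taut; have [t0|/ltW t0] := leP 0 t; first exact/ltW/(small_lt xi u r).
    have [_ uxi _] := sol; rewrite uxi ?taut//.
    apply: (le_trans (xi_le t _)); first by rewrite taut.
    have : 0 <= q by rewrite divr_ge0// ltW.
    nra.
  exact: (delay_mild_solution_cvg0 Sw htau hrho_bound r0 M0 MlamP hf0 flip (to_delay _ _ sol)
    hrho_lim u_le).
pose b := Num.min eps r.
have b0 : 0 < b by rewrite lt_min eps0.
have br : b <= r by rewrite ge_min lexx orbT.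
exists ((1 - q) * b / 2).
  by rewrite small_gt0//= ler_pM2r ?invr_gt0// ler_wpM2l// subr_ge0 ltW.
move=> xi cxi hxi u sol t t0.
apply: (@le_trans _ _ b); last by rewrite ge_min lexx.
exact/ltW/(small_lt xi u b).
Qed.
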